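(* Let $E$ and $F$ be Banach lattices. Then $K^r_{AM-un}(E,F)$ is an AM-space under the norm $\|\cdot\|_{AM-un}$ if and only if $E$ is an AL-space and $F$ is an AM-space.
   Context: For $x\in E_+$, $[-x,x]=\{y\in E:-x\le y\le x\}$. A net $(y_\alpha)$ in $F$ is un-convergent to $y\in F$ if $\||y_\alpha-y|\wedge u\|\to 0$ for every $u\in F_+$. A continuous linear operator $T:E\to F$ is AM-un-compact if for every $x\in E_+$ the bounded set $T[-x,x]$ is un-compact, meaning that every net in $T[-x,x]$ has a subnet that is un-convergent in $F$. $K_{AM-un}(E,F)$ is the set of AM-un-compact operators $E\to F$; operators are ordered by $S\le T$ iff $Sx\le Tx$ for all $x\in E_+$, and $K^+_{AM-un}(E,F)$ is the set of positive elements of $K_{AM-un}(E,F)$. Let $$K^r_{AM-un}(E,F)=\{T\in K_{AM-un}(E,F): \pm T\le S \text{ for some } S\in K^+_{AM-un}(E,F)\}$$ with the induced order. For $T\in K^r_{AM-un}(E,F)$ the AM-un-norm is $$\|T\|_{AM-un}=\inf\{\|S\|: S\in K^+_{AM-un}(E,F),\ S\ge \pm T\},$$ where $\|S\|$ is the operator norm. A Banach lattice $X$ is an AL-space if $\|x+y\|=\|x\|+\|y\|$ for all $x,y\in X_+$, and an AM-space if $\|x\vee y\|=\max\{\|x\|,\|y\|\}$ for all $x,y\in X_+$.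
   Formalization: The Banach lattices E and F are assumed nonzero; otherwise the ''only if'' part fails, e.g. for E = 0 and F = ℓ² the space K^r is {0}, trivially an AM-space, while F is not an AM-space. *)

(* Defs.v *)
From HB Require Import structures.
From mathcomp Require Import all_boot all_order all_algebra.
From mathcomp Require Import all_classical all_reals all_analysis.
Import Order.TTheory GRing.Theory Num.Theory.
Import numFieldNormedType.Exports.

Set Implicit Arguments.
Unset Strict Implicit.
Unset Printing Implicit Defensive.

Local Open Scope classical_set_scope.
Local Open Scope ring_scope.

(* The order data are fields of the mixin instead of a MathComp lattice
   structure: Hierarchy Builder rejects a join of normed modules with the order
   structures, because those already meet inside numDomainType.
   [vjoin] and [vmeet] are forced to be the supremum and infimum for [vle]. *)
HB.mixin Record isBanachLattice (R : realType) E
    & CompleteNormedModule R E := {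
  vle : rel E ;
  vjoin : E -> E -> E ;
  vmeet : E -> E -> E ;
  vle_refl : reflexive vle ;
  vle_anti : antisymmetric vle ;
  vle_trans : transitive vle ;
  vleUx : forall x y z, vle (vjoin x y) z = vle x z && vle y z ;
  vlexI : forall x y z, vle z (vmeet x y) = vle z x && vle z y ;
  vleD2r : forall z x y, vle x y -> vle (x + z) (y + z) ;
  vscale_ge0 : forall (a : R) x, 0 <= a -> vle 0 x -> vle 0 (a *: x) ;
  vle_norm : forall x y : E,
    vle (vjoin x (- x)) (vjoin y (- y)) -> `|x| <= `|y|
}.

#[short(type="banachLatticeType")]
HB.structure Definition BanachLattice (R : realType) :=
  {E of isBanachLattice R E & CompleteNormedModule R E}.

Notation "x <=L y" := (vle x y) (at level 70, no associativity) : ring_scope.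

Definition vabs (R : realType) (E : banachLatticeType R) (x : E) : E :=
  vjoin x (- x).

Definition AL_space (R : realType) (X : banachLatticeType R) : Prop :=
  forall x y : X, 0 <=L x -> 0 <=L y -> `|x + y| = `|x| + `|y|.

Definition AM_space (R : realType) (X : banachLatticeType R) : Prop :=
  forall x y : X, 0 <=L x -> 0 <=L y -> `|vjoin x y| = Num.max `|x| `|y|.

Record directedSet := DirectedSet {
  dset_sort :> Type ;
  dset_le : dset_sort -> dset_sort -> Prop ;
  dset_refl : forall i, dset_le i i ;
  dset_trans : forall i j k, dset_le i j -> dset_le j k -> dset_le i k ;
  dset_inhabited : inhabited dset_sort ;
  dset_directed : forall i j, exists k, dset_le i k /\ dset_le j k
}.

Definition net_tails (I : directedSet) : set_system I :=
  [set A | exists i0 : I, forall i, dset_le i0 i -> A i].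
Arguments net_tails : clear implicits.

#[global] Instance net_tails_filter (I : directedSet) : ProperFilter (net_tails I).
Proof.
split.
  by move=> [i0 /(_ i0)]; apply; exact: dset_refl.
split.
- by have [i0] := dset_inhabited I; exists i0.
- move=> A B [i Ai] [j Bj]; have [k [ik jk]] := dset_directed i j.
  by exists k => l kl; split; [apply: Ai|apply: Bj]; apply: dset_trans kl.
- by move=> A B AB [i Ai]; exists i => j ij; exact/AB/Ai.
Qed.

(* The net y \o h is a subnet of y (in the sense of Kelley). *)
Definition subnet (I J : directedSet) (h : J -> I) : Prop :=
  h @ net_tails J `=>` net_tails I.

Section UnConvergence.
Context {R : realType} {F : banachLatticeType R}.

Definition un_cvg (I : directedSet) (y : I -> F) (z : F) : Prop :=
  forall u : F, 0 <=L u ->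
    `|vmeet (vabs (y i - z)) u| @[i --> net_tails I] --> (0 : R).

Definition un_compact (A : set F) : Prop :=
  forall (I : directedSet) (y : I -> F), (forall i, A (y i)) ->
  exists (J : directedSet) (h : J -> I),
    subnet h /\ exists z : F, un_cvg (y \o h) z.

End UnConvergence.

Section Operators.
Context {R : realType} {E F : banachLatticeType R}.
Implicit Types S T : E -> F.

Definition op_le S T : Prop := forall x : E, 0 <=L x -> S x <=L T x.

Definition op_norm T : R := sup [set `|T x| | x in [set x : E | `|x| <= 1]].

Definition K_AMun : set (E -> F) := [set T |
  [/\ linear T, continuous T &
      forall x : E, 0 <=L x ->
        un_compact (T @` [set y | - x <=L y /\ y <=L x])]].

Definition Kpos_AMun : set (E -> F) := [set T | K_AMun T /\ op_le 0 T].

Definition Kpos_dominating T : set (E -> F) :=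
  [set S | [/\ Kpos_AMun S, op_le T S & op_le (- T) S]].

Definition Kr_AMun : set (E -> F) :=
  [set T | K_AMun T /\ exists S, Kpos_dominating T S].

Definition AMun_norm T : R := inf [set op_norm S | S in Kpos_dominating T].

End Operators.

Arguments Kr_AMun {R} E F.

(* The subset A of V, with the inherited linear operations, the order le and
   the norm N, is an AM-space: the linear bijection phi identifies (A, le, N)
   with a Banach lattice X that is one. In particular A is a vector subspace,
   any two of its elements have a supremum in (A, le), and N is a complete
   lattice norm on A. *)
Definition is_AM_space_under (R : realType) (V : lmodType R) (A : set V)
    (le : V -> V -> Prop) (N : V -> R) : Prop :=
  exists (X : banachLatticeType R) (phi : {linear X -> V}),
    [/\ set_bij [set: X] A phi,
        forall x y : X, x <=L y <-> le (phi x) (phi y),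
        forall x : X, `|x| = N (phi x) &
        AM_space X].

(* Main.v *)
From HB Require Import structures.
Require Import Defs.
From mathcomp Require Import all_boot all_order all_algebra.
From mathcomp Require Import all_classical all_reals all_analysis.
From mathcomp Require Import lra.
Import Order.TTheory GRing.Theory Num.Theory.
Import numFieldNormedType.Exports.

(** Write E -> F for operators between Banach lattices.  An operator T dominated
    by a positive operator S maps [-x, x] into the order interval [-S x, S x].  On
    an order bounded set un-convergence is norm convergence, so for dominated T the
    set T[-x, x] is un-compact exactly when it is totally bounded
    ([un_compact_tbounded], [tbounded_un_compact]).  Thus the regular AM-un-compact
    operators are the dominated operators that are AM-compact for the norm
    ([am_compact]).

    Suppose that F is an AM-space.  There finitely many vectors of norm at most e
    have a common majorant of norm at most e, so that the finite suprema over finer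
    and finer nets of a totally bounded set A converge: sup A exists, and its norm is
    at most the supremum of the norms of the elements of A ([tbounded_vlub],
    [norm_vlub]).  Hence the Riesz-Kantorovich formula T^+ x = sup T[0, x] defines a
    positive operator, which is AM-compact again because the suprema of parts of
    T[0, x] form a totally bounded set ([tbounded_vlubs], [am_compact_pos]).  The
    AM-compact operators therefore form a vector lattice.  Moreover |T| has the
    operator norm of T, so every AM-compact operator is regular and the AM-un-norm is
    the operator norm ([am_compact_abs], [AMun_normE]), for which AM-compact operators
    are complete ([amop_complete]).  If in addition E is an AL-space, then for S,
    T >= 0 and 0 <= y <= x
      [|S y + T (x - y)| <= max(|S|, |T|) (|y| + |x - y|) = max(|S|, |T|) |x|],
    and (S v T) x is the supremum of the vectors S y + T (x - y); this is the
    AM-identity ([AM_space_sufficient]).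

    Conversely, let the operators form an AM-space.  The Hahn-Banach theorem for the
    sublinear functional x |-> |x^+| gives, for every x0 >= 0, a positive functional
    of norm at most one with f x0 = |x0|.  For a fixed such f with x0 <> 0, the rank
    one operators x |-> f x *: y embed F isometrically as a sublattice, so F is an
    AM-space ([AM_space_codomain]).  For f and g norming x1 and x2 and |y| = 1, the
    join W of the operators x |-> f x *: y and x |-> g x *: y has norm at most one,
    and W (x1 + x2) >= (|x1| + |x2|) *: y; so |x1| + |x2| <= |x1 + x2| and E is an
    AL-space ([AL_space_domain]). *)

Set Implicit Arguments.
Unset Strict Implicit.
Unset Printing Implicit Defensive.

Local Open Scope classical_set_scope.
Local Open Scope ring_scope.
(** * Vector lattices *)

Section VectorLattice.
Context {R : realType} {E : banachLatticeType R}.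
Implicit Types (x y z u v w : E) (a : R).

Definition vpos x := vjoin x 0.

Lemma vlexx x : x <=L x. Proof. exact: vle_refl. Qed.
Hint Resolve vlexx : core.

Lemma vle_tr y x z : x <=L y -> y <=L z -> x <=L z.
Proof. exact: vle_trans. Qed.

Lemma vle_asym x y : x <=L y -> y <=L x -> x = y.
Proof. by move=> xy yx; apply: vle_anti; rewrite xy yx. Qed.

Lemma vleD x y z w : x <=L y -> z <=L w -> x + z <=L y + w.
Proof.
move=> xy zw; apply: (vle_tr (vleD2r z _ _ xy)).
by rewrite addrC [y + w]addrC; exact: vleD2r.
Qed.

Lemma vleDr z x y : (x + z <=L y + z) = (x <=L y).
Proof.
apply/idP/idP => [/(vleD2r (- z) _ _)|]; last exact: vleD2r.
by rewrite !addrK.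
Qed.

Lemma vleBlDr x y z : (x - y <=L z) = (x <=L z + y).
Proof. by rewrite -(vleDr y) subrK. Qed.

Lemma vleBrDr x y z : (x <=L y - z) = (x + z <=L y).
Proof. by rewrite -(vleDr z) subrK. Qed.

Lemma vsubr_ge0 x y : (0 <=L y - x) = (x <=L y).
Proof. by rewrite vleBrDr add0r. Qed.

Lemma vleN x y : (- x <=L - y) = (y <=L x).
Proof. by rewrite -(vleDr x) addNr addrC vsubr_ge0. Qed.

Lemma vleNl x y : (- x <=L y) = (- y <=L x).
Proof. by rewrite -{1}[y]opprK vleN. Qed.

Lemma voppr_le0 x : (- x <=L 0) = (0 <=L x).
Proof. by rewrite -{1}oppr0 vleN. Qed.

Lemma vaddr_ge0 x y : 0 <=L x -> 0 <=L y -> 0 <=L x + y.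
Proof. by move=> x0 y0; rewrite -[0]addr0; exact: vleD. Qed.

Lemma vleDl x y : 0 <=L y -> x <=L x + y.
Proof. by move=> y0; rewrite -{1}[x]addr0; exact: vleD. Qed.

Lemma vleZ a x y : 0 <= a -> x <=L y -> a *: x <=L a *: y.
Proof.
by move=> a0 xy; rewrite -vsubr_ge0 -scalerBr vscale_ge0// vsubr_ge0.
Qed.

Lemma vleUl x y : x <=L vjoin x y.
Proof. by have := vlexx (vjoin x y); rewrite vleUx => /andP[]. Qed.

Lemma vleUr x y : y <=L vjoin x y.
Proof. by have := vlexx (vjoin x y); rewrite vleUx => /andP[]. Qed.

Lemma vleU x y z : x <=L z -> y <=L z -> vjoin x y <=L z.
Proof. by rewrite vleUx => -> ->. Qed.

Lemma vleIl x y : vmeet x y <=L x.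
Proof. by have := vlexx (vmeet x y); rewrite vlexI => /andP[]. Qed.

Lemma vleI x y z : z <=L x -> z <=L y -> z <=L vmeet x y.
Proof. by rewrite vlexI => -> ->. Qed.

Lemma vmeet_idl x y : x <=L y -> vmeet x y = x.
Proof. by move=> xy; apply: vle_asym; rewrite ?vleIl// vleI. Qed.

Lemma vjoin_idl x y : y <=L x -> vjoin x y = x.
Proof. by move=> xy; apply: vle_asym; rewrite ?vleUl// vleU. Qed.

Lemma vpos_ge0 x : 0 <=L vpos x. Proof. exact: vleUr. Qed.
Lemma vle_vpos x : x <=L vpos x. Proof. exact: vleUl. Qed.
Hint Resolve vpos_ge0 vle_vpos : core.

Lemma vpos_id x : 0 <=L x -> vpos x = x. Proof. exact: vjoin_idl. Qed.

Lemma vpos_le0 x : x <=L 0 -> vpos x = 0.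
Proof. by move=> x0; apply: vle_asym => //; exact: vleU. Qed.

Lemma vposBneg x : vpos x - vpos (- x) = x.
Proof.
suff -> : vpos (- x) = vpos x - x by rewrite opprB addrC subrK.
apply: vle_asym; first by apply: vleU; rewrite ?vleBrDr ?addNr ?add0r.
rewrite vleBlDr; apply: vleU; first by rewrite addrC; exact: vleDl.
by rewrite -vleBlDr sub0r.
Qed.

Lemma vle_abs x : x <=L vabs x. Proof. exact: vleUl. Qed.
Lemma vleN_abs x : - x <=L vabs x. Proof. exact: vleUr. Qed.
Hint Resolve vle_abs vleN_abs : core.

Lemma vabs_le x y : x <=L y -> - x <=L y -> vabs x <=L y.
Proof. exact: vleU. Qed.

Lemma scaler_half x : 2^-1 *: (x + x) = x.
Proof.
by rewrite -mulr2n -(scaler_nat 2 x) scalerA mulVf ?pnatr_eq0// scale1r.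
Qed.

Lemma vge0_of_pm x y : x <=L y -> - x <=L y -> 0 <=L y.
Proof.
move=> xy nxy; rewrite -(scaler_half y).
by apply: vscale_ge0; rewrite ?invr_ge0// -(subrr x); exact: vleD.
Qed.

Lemma vabs_ge0 x : 0 <=L vabs x. Proof. exact: (@vge0_of_pm x). Qed.
Hint Resolve vabs_ge0 : core.

Lemma vabs_id x : 0 <=L x -> vabs x = x.
Proof.
by move=> x0; apply: vjoin_idl; apply: (vle_tr _ x0); rewrite voppr_le0.
Qed.

Lemma vabsN x : vabs (- x) = vabs x.
Proof.
suff H y : vabs (- y) <=L vabs y by apply: vle_asym; rewrite // -{1}[x]opprK.
by apply: vabs_le; rewrite ?opprK.
Qed.

Lemma vabsD x y : vabs (x + y) <=L vabs x + vabs y.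
Proof. by apply: vabs_le; rewrite ?opprD; exact: vleD. Qed.

Lemma vabs_posD x : vpos x + vpos (- x) = vabs x.
Proof.
apply: vle_asym; last first.
  apply: vabs_le; first by apply: (vle_tr (vle_vpos x)); exact: vleDl.
  by apply: (vle_tr (vle_vpos (- x))); rewrite addrC; exact: vleDl.
have -> : vpos (- x) = vpos x - x.
  by rewrite -{3}[x]vposBneg opprB addrC subrK.
suff vx : vpos x <=L 2^-1 *: (vabs x + x).
  by rewrite addrA vleBlDr -(scaler_half (vabs x + x)) scalerDr; exact: vleD.
apply: vleU; last first.
  by apply: vscale_ge0; rewrite ?invr_ge0// addrC -(subrr x); exact: vleD.
by rewrite -{1}[x]scaler_half; apply: vleZ; rewrite ?invr_ge0//; exact: vleD.
Qed.

Lemma norm_vabs x : `|vabs x| = `|x|.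
Proof.
by apply/eqP; rewrite eq_le; apply/andP; split; apply: vle_norm;
  rewrite -!/(vabs _) (vabs_id (vabs_ge0 x)).
Qed.

Lemma vle_normr x y : x <=L y -> - x <=L y -> `|x| <= `|y|.
Proof.
move=> xy nxy; apply: vle_norm; rewrite -!/(vabs _).
by apply: (vle_tr (vabs_le xy nxy)).
Qed.

Lemma vle_norm_ge0 x y : 0 <=L x -> x <=L y -> `|x| <= `|y|.
Proof.
move=> x0 xy; apply: vle_normr => //; apply: vle_tr (vle_tr x0 xy).
by rewrite voppr_le0.
Qed.

Lemma vpos_le_abs x : vpos x <=L vabs x. Proof. exact: vleU. Qed.

Lemma norm_vpos x : `|vpos x| <= `|x|.
Proof. by rewrite -[leRHS]norm_vabs; exact: vle_norm_ge0 (vpos_le_abs x). Qed.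

(** This is the closedness of the positive cone: the norm of the positive part of
    [x - y] is at most that of every [w]. *)
Lemma vle_approx x y :
  (forall e : R, 0 < e -> exists2 w, x <=L y + w & `|w| <= e) -> x <=L y.
Proof.
move=> H; rewrite -[y]add0r -vleBlDr.
suff vp0 : vpos (x - y) = 0 by rewrite -vp0.
apply/eqP; rewrite -normr_le0; apply/ler_addgt0Pr => e e0; rewrite add0r.
have [w xw we] := H e e0.
apply: (le_trans _ we); rewrite -norm_vabs [leRHS](esym (norm_vabs _)).
rewrite vabs_id//; apply: vle_norm_ge0 => //; apply: vleU => //.
by apply: (@vle_tr w) => //; rewrite vleBlDr addrC.
Qed.

(** The part of [z] that is charged to [y] is the excess of [z] over [x], namely
    the positive part of [z - x]. *)
Lemma riesz_decomposition x y z : 0 <=L x -> 0 <=L y -> 0 <=L z -> z <=L x + y ->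
  exists z1 z2, [/\ z = z1 + z2, 0 <=L z1, z1 <=L x, 0 <=L z2 & z2 <=L y].
Proof.
move=> x0 y0 z0 zxy; exists (z - vpos (z - x)), (vpos (z - x)); split => //.
- by rewrite subrK.
- by rewrite vsubr_ge0; apply: vleU => //; rewrite vleBlDr; exact: vleDl.
- by rewrite vleBlDr addrC -vleBlDr.
- by apply: vleU => //; rewrite vleBlDr addrC.
Qed.

Definition is_vlub (A : set E) b := forall z, b <=L z <-> (forall x, A x -> x <=L z).

Lemma vlub_ub A b x : is_vlub A b -> A x -> x <=L b.
Proof. by move=> Ab; apply: (Ab b).1. Qed.

Lemma vlub_least A b z : is_vlub A b -> (forall x, A x -> x <=L z) -> b <=L z.
Proof. by move=> Ab; apply: (Ab z).2. Qed.

Lemma vlub_uniq A b c : is_vlub A b -> is_vlub A c -> b = c.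
Proof.
by move=> Ab Ac; apply: vle_asym; [apply: (vlub_least Ab)|apply: (vlub_least Ac)];
  move=> x; apply: vlub_ub.
Qed.

Lemma vlubD (A B : set E) (a b : E) : is_vlub A a -> is_vlub B b ->
  is_vlub [set x | exists p q, [/\ A p, B q & x = p + q]] (a + b).
Proof.
move=> Aa Bb z; split=> [abz x [p [q [Ap Bq ->]]]|H].
  by apply: vle_tr abz; apply: vleD; [exact: vlub_ub Ap|exact: vlub_ub Bq].
rewrite addrC -vleBrDr; apply: (vlub_least Bb) => q Bq.
rewrite vleBrDr addrC -vleBrDr; apply: (vlub_least Aa) => p Ap.
by rewrite vleBrDr; apply: H; exists p, q.
Qed.

Lemma vlubZ (A : set E) b a : 0 < a -> is_vlub A b ->
  is_vlub [set x | exists2 p, A p & x = a *: p] (a *: b).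
Proof.
move=> a0 Ab z; split=> [abz x [p Ap ->]|H].
  by apply: vle_tr abz; apply: vleZ; [exact: ltW|exact: vlub_ub Ap].
have -> : z = a *: (a^-1 *: z) by rewrite scalerA divff ?scale1r// gt_eqF.
apply: vleZ; first exact: ltW.
apply: (vlub_least Ab) => p Ap.
have -> : p = a^-1 *: (a *: p) by rewrite scalerA mulVf ?scale1r// gt_eqF.
by apply: vleZ; [rewrite invr_ge0 ltW|apply: H; exists p].
Qed.

End VectorLattice.

#[global] Hint Resolve vlexx vpos_ge0 vle_vpos vle_abs vleN_abs vabs_ge0 : core.

(** * Totally bounded sets *)

Section TotallyBounded.
Context {R : realType}.
Implicit Types (F G : normedModType R).

Definition enet F (e : R) (A : set F) (s : seq F) :=
  forall a, A a -> exists2 b, b \in s & `|a - b| <= e.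

Definition tbounded F (A : set F) :=
  forall e : R, 0 < e -> exists s : seq F, enet e A s.

Lemma sub_tbounded F (A B : set F) : A `<=` B -> tbounded B -> tbounded A.
Proof.
by move=> AB tB e /tB[s sB]; exists s => a /AB /sB.
Qed.

(** Centres are moved into the set: each centre of a net of radius [e / 2] that is
    near the set is replaced with a point of the set near it. *)
Lemma tbounded_inner F (A : set F) (e : R) : tbounded A -> 0 < e ->
  exists s, enet e A s /\ (forall b, b \in s -> A b).
Proof.
move=> tA e0; have [s sA] := tA (e / 2) (divr_gt0 e0 (ltr0n R 2)).
pose near_ (b a : F) := A a /\ `|a - b| <= e / 2.
pose s' := [seq get (near_ b) | b <- s & `[< exists a, near_ b a >]].
exists s'; split=> [a Aa|b /mapP[c]]; last first.
  rewrite mem_filter => /andP[/asboolP[a nca] _] ->.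
  by have [] := getPex (ex_intro _ a nca).
have [b bs ab] := sA a Aa; exists (get (near_ b)).
  apply/mapP; exists b => //; rewrite mem_filter bs andbT; apply/asboolP.
  by exists a.
have [_ gb] := getPex (ex_intro (near_ b) a (conj Aa ab)).
rewrite -(subrKA b) (le_trans (ler_normD _ _))// [leRHS](splitr e) lerD//.
by rewrite distrC.
Qed.

Lemma tbounded_approx F (A : set F) :
  (forall e : R, 0 < e -> exists2 B : set F, tbounded B &
     forall a, A a -> exists2 b, B b & `|a - b| <= e) -> tbounded A.
Proof.
move=> H e e0; have e20 : 0 < e / 2 by rewrite divr_gt0.
have [B tB AB] := H _ e20; have [s sB] := tB _ e20.
exists s => a /AB[b /sB[c cs bc] ab]; exists c => //.
by rewrite -(subrKA b) (le_trans (ler_normD _ _))// [leRHS](splitr e) lerD.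
Qed.

Lemma tbounded_image F G (f : F -> G) (k : R) (A : set F) :
  0 <= k -> (forall a b, `|f a - f b| <= k * `|a - b|) ->
  tbounded A -> tbounded (f @` A).
Proof.
move=> k0 fk tA e e0; have k1 : 0 < k + 1 by rewrite ltr_wpDl.
have [s sA] := tA (e / (k + 1)) (divr_gt0 e0 k1).
exists [seq f b | b <- s] => _ [a /sA[b bs ab] <-].
exists (f b); first exact: map_f.
rewrite (le_trans (fk _ _))// (le_trans (ler_wpM2l k0 ab))//.
rewrite mulrCA ler_piMr ?(ltW e0)// ler_pdivrMr// mul1r.
by rewrite lerDl.
Qed.

Lemma tboundedD F (A B : set F) : tbounded A -> tbounded B ->
  tbounded [set x | exists p q, [/\ A p, B q & x = p + q]].
Proof.
move=> tA tB e e0; have e20 : 0 < e / 2 by rewrite divr_gt0.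
have [[s sA] [t tB']] := (tA _ e20, tB _ e20).
exists [seq a + b | a <- s, b <- t] => _ [p [q [/sA[a sa pa] /tB'[b tb qb] ->]]].
exists (a + b); first by apply/allpairsP; exists (a, b).
by rewrite opprD addrACA (le_trans (ler_normD _ _))// [leRHS](splitr e) lerD.
Qed.

End TotallyBounded.

(** If for each [e] some but inexactly determined point is known up to [e],
    completeness provides the point itself. *)
Lemma complete_approx {R : realType} (F : completeNormedModType R)
    (P : R -> set F) :
  (forall e, 0 < e -> exists a, P e a) ->
  (forall e d a b, 0 < e -> 0 < d -> P e a -> P d b -> `|a - b| <= e + d) ->
  exists l, forall e a, 0 < e -> P e a -> `|a - l| <= e.
Proof.
move=> Pex Pdist.
pose d (n : nat) : R := n.+1%:R^-1.
have d0 n : 0 < d n by rewrite invr_gt0.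
have [u Pu] := choice (fun n => Pex (d n) (d0 n)).
have du : d n @[n --> \oo] --> (0 : R) by exact: cvg_harmonic.
have /cauchy_cvgP ucvg : cauchy (u @ \oo).
  apply/cauchy_ballP => e e0.
  have e20 : 0 < e / 2 by rewrite divr_gt0.
  have [N _ dN] : \forall n \near \oo, d n < e / 2.
    have /cvgrPdist_lt /(_ _ e20) := du.
    by apply: filterS => n; rewrite sub0r normrN gtr0_norm.
  exists (u @` [set n | (N <= n)%N], u @` [set n | (N <= n)%N]) => /=.
    by split; exists N => // n /= Nn; exists n.
  move=> [_ _] [[n Nn <-] [m Nm <-]]; rewrite /= -ball_normE /=.
  rewrite (le_lt_trans (Pdist _ _ _ _ (d0 n) (d0 m) (Pu n) (Pu m)))//.
  by rewrite [ltRHS]splitr ltrD// dN.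
exists (lim (u @ \oo)) => e a e0 Pa.
have : (e + d n) @[n --> \oo] --> e + 0 by apply: cvgD => //; exact: cvg_cst.
rewrite addr0 => edn.
have al : `|a - u n| @[n --> \oo] --> `|a - lim (u @ \oo)|.
  by apply: cvg_norm; apply: cvgB => //; exact: cvg_cst.
rewrite -(cvg_lim _ al)// -(cvg_lim _ edn)//.
apply: ler_lim; [exact: cvgP al|exact: cvgP edn|].
by near=> n; exact: Pdist.
Unshelve. all: by end_near. Qed.

(** * Suprema of totally bounded sets in AM-spaces *)

Section AMSup.
Context {R : realType} {F : banachLatticeType R}.
Hypothesis FAM : AM_space F.
Implicit Types (x y z u v w a b c : F) (A B : set F).

(** The value [0] at the empty sequence is a convention. *)
Definition vsups (s : seq F) := if s is x :: s' then foldr vjoin x s' else 0.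

Lemma vsups_le s z : s != [::] -> (vsups s <=L z) = all (vle^~ z) s.
Proof.
case: s => // x s _ /=; elim: s => [|y s IH] /=; first by rewrite andbT.
by rewrite vleUx IH andbCA.
Qed.

Lemma vsups_ub s x : x \in s -> x <=L vsups s.
Proof.
move=> xs; have s0 : s != [::] by case: s xs.
by have := vlexx (vsups s); rewrite vsups_le// => /allP; exact.
Qed.

(** What the AM-identity is used for: a finite set of small vectors has a small
    common majorant. *)
Lemma am_majorant z (s : seq F) (e : R) : 0 <= e ->
  (forall y, y \in s -> exists2 x, x <=L z & `|y - x| <= e) ->
  exists w, [/\ 0 <=L w, `|w| <= e & forall y, y \in s -> y <=L z + w].
Proof.
move=> e0; elim: s => [|y s IH] H; first by exists 0; split; rewrite ?normr0.
have [|w [w0 we ws]] := IH; first by move=> v vs; apply: H; rewrite inE vs orbT.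
have [x xz yxe] := H y (mem_head _ _).
exists (vjoin (vabs (y - x)) w); split.
- exact: vle_tr (vabs_ge0 _) (vleUl _ _).
- by rewrite FAM// ge_max norm_vabs yxe.
- move=> v; rewrite inE => /predU1P[->|/ws vw].
    rewrite -[X in X <=L _](subrK x) addrC; apply: vleD => //.
    exact: vle_tr (vle_abs _) (vleUl _ _).
  by apply: (vle_tr vw); apply: vleD => //; exact: vleUr.
Qed.

(** Both differences have majorants of norm at most [e]; the AM-identity applied to
    their join gives [e] again, not [2 e]. *)
Lemma vsups_dist (s t : seq F) (e : R) : s != [::] -> t != [::] -> 0 <= e ->
  (forall y, y \in s -> exists2 x, x \in t & `|y - x| <= e) ->
  (forall y, y \in t -> exists2 x, x \in s & `|y - x| <= e) ->
  `|vsups s - vsups t| <= e.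
Proof.
move=> s0 t0 e0 st ts.
have half (p q : seq F) : p != [::] ->
    (forall y, y \in p -> exists2 x, x \in q & `|y - x| <= e) ->
    exists w, [/\ 0 <=L w, `|w| <= e & vsups p - vsups q <=L w].
  move=> p0 pq; have [|w [w0 we pw]] := @am_majorant (vsups q) p e e0.
    by move=> y /pq[x /vsups_ub xq yx]; exists x.
  exists w; split=> //; rewrite vleBlDr addrC vsups_le//.
  by apply/allP => y /pw.
have [w [w0 we stw]] := half s t s0 st.
have [v [v0 ve tsv]] := half t s t0 ts.
apply: (@le_trans _ _ `|vjoin w v|); last by rewrite FAM// ge_max we.
apply: vle_normr; first exact: vle_tr (vleUl _ _).
by rewrite opprB; apply: vle_tr (vleUr _ _).
Qed.

Lemma norm_vsups (s : seq F) (c : R) : 0 <= c ->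
  (forall x, x \in s -> `|x| <= c) -> `|vsups s| <= c.
Proof.
move=> c0; case: s => [|x s] H; first by rewrite normr0.
rewrite -[vsups _]subr0 -[0]/(vsups [:: 0]); apply: vsups_dist => // y ys.
  by exists 0; rewrite ?mem_head// subr0 H.
exists x; rewrite ?mem_head//; move: ys; rewrite inE => /eqP ->.
by rewrite sub0r normrN H// mem_head.
Qed.

(** A totally bounded set has a supremum: the finite suprema over finer and
    finer nets form a Cauchy sequence. *)
Lemma tbounded_vlub A : tbounded A -> A !=set0 ->
  exists2 b, is_vlub A b &
  forall (e : R) s, 0 < e -> enet e A s -> (forall x, x \in s -> A x) ->
     `|vsups s - b| <= e.
Proof.
move=> tA [a0 Aa0].
pose good (e : R) (s : seq F) := enet e A s /\ (forall x, x \in s -> A x).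
have gne e s : good e s -> s != [::].
  by move=> [sA _]; have [x] := sA _ Aa0; case: s {sA}.
pose P (e : R) : set F := [set b | exists2 s, good e s & b = vsups s].
have [e e0|e d _ _ e0 d0 [s gs ->] [t gt ->]|b bP] := @complete_approx _ F P.
- by have [s gs] := tbounded_inner tA e0; exists (vsups s), s.
- have [es ds] : e <= e + d /\ d <= e + d by rewrite lerDl lerDr !ltW.
  apply: vsups_dist; [exact: gne gs|exact: gne gt|by rewrite addr_ge0// ltW| |].
    move=> y /gs.2 /gt.1[x xt yx]; exists x => //; exact: le_trans ds.
  move=> y /gt.2 /gs.1[x xs yx]; exists x => //; exact: le_trans es.
exists b; last by move=> e s e0 sA As; apply: (bP _ _ e0); exists s.
move=> z; split=> [bz x Ax|H]; last first.
  apply: vle_approx => e e0; have [s gs] := tbounded_inner tA e0.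
  exists (b - vsups s).
    rewrite addrCA; apply: vleDl; rewrite vsubr_ge0 vsups_le ?(gne _ _ gs)//.
    by apply/allP => x /gs.2 /H.
  by rewrite distrC; apply: bP => //; exists s.
apply: vle_approx => e e0; have e20 : 0 < e / 2 by rewrite divr_gt0.
have [s gs] := tbounded_inner tA e20.
have [y ys xy] := gs.1 x Ax.
exists ((vsups s - b) + (x - y)); last first.
  rewrite (le_trans (ler_normD _ _))// [leRHS]splitr lerD//.
  by apply: bP => //; exists s.
rewrite [X in _ <=L X](AC (1*(2*2)) (4*((1*3)*(2*5))))/=; apply: vleDl.
by apply: vaddr_ge0; rewrite vsubr_ge0// vsups_ub.
Qed.

(** The bound for finite suprema passes to the limit. *)
Lemma norm_vlub A b (c : R) : tbounded A -> A !=set0 -> is_vlub A b ->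
  (forall x, A x -> `|x| <= c) -> `|b| <= c.
Proof.
move=> tA A0 Ab Ac; have [b' Ab' bP] := tbounded_vlub tA A0.
rewrite (vlub_uniq Ab Ab'); apply/ler_addgt0Pr => e e0.
have [s [sA As]] := tbounded_inner tA e0.
have c0 : 0 <= c by have [a /Ac] := A0; exact: le_trans.
rewrite -[b'](subKr (vsups s)) (le_trans (ler_normB _ _))// lerD//.
  by apply: norm_vsups => // x /As /Ac.
exact: bP.
Qed.

(** Suprema over parts of [A] are approximated by the finitely many suprema over
    parts of a finite net of [A]. *)
Lemma tbounded_vlubs A : tbounded A ->
  tbounded [set b | exists B, [/\ B `<=` A, B !=set0 & is_vlub B b]].
Proof.
move=> tA e e0; pose d := e / 2 / 2.
have d0 : 0 < d by rewrite /d !divr_gt0.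
have [s sA] := tA d d0.
exists [seq vsups (mask m s) | m : (size s).-tuple bool] => b [B [BA B0 Bb]].
have tB : tbounded B by exact: sub_tbounded tA.
pose near_ (c : F) := `[< exists2 y, B y & `|y - c| <= d >].
exists (vsups [seq c <- s | near_ c]).
  apply/mapP; exists (map_tuple near_ (in_tuple s)); first by rewrite mem_enum.
  by rewrite /= -filter_mask.
have [t [tBt Bt]] := tbounded_inner tB d0.
have [b' Bb' bP] := tbounded_vlub tB B0; rewrite (vlub_uniq Bb Bb').
have {bP} bt := bP _ _ d0 tBt Bt.
have ns y : B y -> exists2 x, x \in [seq c <- s | near_ c] & `|y - x| <= d.
  move=> By; have [x xs yx] := sA y (BA _ By); exists x => //.
  by rewrite mem_filter xs andbT; apply/asboolP; exists y.
have [y0 By0] := B0.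
have dd : d <= e / 2 by rewrite ler_pdivrMr// mulr_natr mulr2n lerDl ltW// divr_gt0.
rewrite -(subrKA (vsups t)) (le_trans (ler_normD _ _))// [leRHS]splitr lerD//.
  by rewrite distrC (le_trans bt).
apply: vsups_dist.
- by have [x] := tBt _ By0; case: (t).
- by have [x] := ns _ By0; case: seq.filter.
- by rewrite divr_ge0// ltW.
- by move=> y /Bt /ns[x xs yx]; exists x => //; apply: le_trans dd.
- move=> x; rewrite mem_filter => /andP[/asboolP[y By yx] _].
  have [v vt yv] := tBt y By; exists v => //.
  rewrite -(subrKA y) (le_trans (ler_normD _ _))// [leRHS]splitr lerD//.
  by rewrite distrC.
Qed.

End AMSup.

(** * Bounded linear maps *)

Section LinearMaps.
Context {R : realType} {E F : normedModType R}.
Implicit Types (S T : E -> F) (c : R).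

Lemma lin0 T : linear T -> T 0 = 0.
Proof. by move=> lT; have := lT (-1) 0 0; rewrite !scaleN1r oppr0 addr0 addNr. Qed.

Lemma linZ T : linear T -> forall a x, T (a *: x) = a *: T x.
Proof. by move=> lT a x; have := lT a x 0; rewrite lin0// !addr0. Qed.

Lemma linD T : linear T -> {morph T : x y / x + y}.
Proof. by move=> lT x y; have := lT 1 x y; rewrite !scale1r. Qed.

Lemma linN T : linear T -> {morph T : x / - x}.
Proof. by move=> lT x; rewrite -scaleN1r linZ// scaleN1r. Qed.

Lemma linB T : linear T -> {morph T : x y / x - y}.
Proof. by move=> lT x y; rewrite linD// linN. Qed.

Lemma lin_comb (a : R) S T : linear S -> linear T -> linear (a *: S + T).
Proof.
move=> lS lT b x y; rewrite !fctE lS lT.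
by rewrite !scalerDr !scalerA [b * a]mulrC addrACA.
Qed.

Lemma lin_opp T : linear T -> linear (- T).
Proof. by move=> lT a x y; rewrite !fctE lT opprD scalerN. Qed.

Definition bounded_by c T := forall x, `|T x| <= c * `|x|.

Lemma continuous_boundedP T : linear T ->
  (continuous T <-> exists2 c, 0 <= c & bounded_by c T).
Proof.
move=> lT.
pose lm := GRing.isLinear.Build R E F *:%R T lT.
pose f : {linear E -> F} := HB.pack T lm.
split=> [cT|[c c0 bc]].
  have /linear_boundedP[M [_ /(_ (`|M| + 1))]] : bounded_near f (nbhs 0).
    by apply/linear_bounded_continuous => x; exact: cT.
  move=> H; exists (`|M| + 1); first by rewrite addr_ge0.
  by apply: H; rewrite ltr_pwDr// real_ler_norm// num_real.
have : bounded_near f (nbhs 0).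
  apply/linear_boundedP; exists c; split; first exact: num_real.
  by move=> M cM x; rewrite (le_trans (bc x))// ler_wpM2r// ltW.
by move/linear_bounded_continuous => H x; exact: H.
Qed.

End LinearMaps.

Section OpNorm.
Context {R : realType} {E F : banachLatticeType R}.
Implicit Types (S T : E -> F) (c : R).

Lemma op_norm_le c T : 0 <= c -> bounded_by c T -> op_norm T <= c.
Proof.
move=> c0 bT; apply: ge_sup; first by exists `|T 0|, 0 => //=; rewrite normr0.
by move=> _ [x /= x1 <-]; rewrite (le_trans (bT x))// ler_piMr.
Qed.

Lemma has_sup_op_norm c T : 0 <= c -> bounded_by c T ->
  has_sup [set `|T x| | x in [set x : E | `|x| <= 1]].
Proof.
move=> c0 bT; split; first by exists `|T 0|, 0 => //=; rewrite normr0.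
by exists c => _ [x /= x1 <-]; rewrite (le_trans (bT x))// ler_piMr.
Qed.

Lemma op_norm_ge0 c T : 0 <= c -> bounded_by c T -> 0 <= op_norm T.
Proof.
move=> c0 bT; apply: (@le_trans _ _ `|T 0|) => //.
apply: ub_le_sup; first exact: (has_sup_op_norm c0 bT).2.
by exists 0; rewrite //= normr0.
Qed.

Lemma bounded_op_norm c T : linear T -> 0 <= c -> bounded_by c T ->
  bounded_by (op_norm T) T.
Proof.
move=> lT c0 bT x; have [->|x0] := eqVneq x 0.
  by rewrite lin0// !normr0 mulr0.
have nx : 0 < `|x| by rewrite normr_gt0.
rewrite -ler_pdivrMr// mulrC.
have -> : `|x|^-1 * `|T x| = `|T (`|x|^-1 *: x)|.
  by rewrite linZ// normrZ ger0_norm// invr_ge0.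
apply: ub_le_sup; first exact: (has_sup_op_norm c0 bT).2.
exists (`|x|^-1 *: x) => //=.
by rewrite normrZ ger0_norm ?invr_ge0// mulVf// gt_eqF.
Qed.

End OpNorm.

(** * AM-compact operators *)

Section AMCompact.
Context {R : realType} {E F : banachLatticeType R}.
Implicit Types (S T W : E -> F) (x y : E) (c : R).

Definition vitv x y : set E := [set z | x <=L z /\ z <=L y].

(** For a dominated operator, AM-un-compactness amounts to this notion, which
    speaks of the norm only. *)
Definition am_compact T :=
  [/\ linear T, exists2 c, 0 <= c & bounded_by c T &
      forall x, 0 <=L x -> tbounded (T @` vitv (- x) x)].

Definition positive T := forall x, 0 <=L x -> 0 <=L T x.

Lemma positive_le T x y : linear T -> positive T -> x <=L y -> T x <=L T y.
Proof.
move=> lT pT xy; rewrite -vsubr_ge0 -linB//; apply: pT.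
by rewrite vsubr_ge0.
Qed.

(** Splitting [x] into its positive and negative parts gives [T x <= S |x|]. *)
Lemma dominated_norm S T x : linear S -> linear T ->
  op_le T S -> op_le (- T) S -> `|T x| <= `|S (vabs x)|.
Proof.
move=> lS lT TS NTS.
have step (U : E -> F) : linear U -> op_le U S -> op_le (- U) S ->
    U x <=L S (vabs x).
  move=> lU US NUS; rewrite -{1}[x]vposBneg -vabs_posD linB// linD//.
  by apply: vleD; [exact: US|exact: NUS].
apply: vle_normr; first exact: step.
apply: (step (- T)) => //; last by rewrite opprK.
exact: lin_opp.
Qed.

Lemma positive_bounded T c : linear T -> positive T ->
  (forall x, 0 <=L x -> `|T x| <= c * `|x|) -> bounded_by c T.
Proof.
move=> lT pT bT x; rewrite -(norm_vabs x); apply: le_trans (bT _ (vabs_ge0 x)).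
apply: dominated_norm => // y y0 //.
rewrite fctE -linN//; apply: positive_le => //.
by apply: (vle_tr _ y0); rewrite voppr_le0.
Qed.

Lemma am_compact_comb (a : R) S T : am_compact S -> am_compact T ->
  am_compact (a *: S + T).
Proof.
move=> [lS [c c0 bS] tS] [lT [d d0 bT] tT]; split; first exact: lin_comb.
  exists (`|a| * c + d); first by rewrite addr_ge0// mulr_ge0.
  move=> x; rewrite fctE (le_trans (ler_normD _ _))// mulrDl lerD//.
  by rewrite fctE normrZ -mulrA ler_wpM2l.
move=> x x0; have taS : tbounded ( *:%R a @` (S @` vitv (- x) x)).
  apply: (tbounded_image (normr_ge0 a)) (tS x x0) => u v.
  by rewrite -scalerBr normrZ.
apply: sub_tbounded (tboundedD taS (tT x x0)) => _ [y yx <-].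
exists (a *: S y), (T y); split; last by [].
  by exists (S y) => //; exists y.
by exists y.
Qed.

Lemma am_compact0 : am_compact 0.
Proof.
split=> [a x y||x x0 e e0]; first by rewrite /= scaler0 addr0.
  by exists 0 => // x; rewrite normr0 mul0r.
exists [:: 0] => _ [y _ <-]; exists 0; first exact: mem_head.
by rewrite subrr normr0 ltW.
Qed.

Lemma am_compact_opp T : am_compact T -> am_compact (- T).
Proof.
move=> amT; rewrite -scaleN1r -[_ *: _]addr0.
exact: am_compact_comb am_compact0.
Qed.

(** [S] maps [-x, x] into an [e |x|]-neighbourhood of [T [-x, x]] and conversely, so
    total boundedness passes to limits in operator norm. *)
Lemma am_compact_limit T : linear T ->
  (forall e, 0 < e -> exists2 S, am_compact S & bounded_by e (S - T)) ->
  am_compact T.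
Proof.
move=> lT H; split=> // [|x x0].
  have [S [lS [c c0 bS] _] ST] := H 1 ltr01; exists (c + 1).
    by rewrite addr_ge0.
  move=> x; rewrite -[T x](subKr (S x)) (le_trans (ler_normB _ _))//.
  by rewrite mulrDl lerD// ST.
apply: tbounded_approx => e e0.
have n0 : 0 < `|x| + 1 by rewrite ltr_wpDl.
have [S [lS _ tS] ST] := H _ (divr_gt0 e0 n0).
exists (S @` vitv (- x) x); first exact: tS.
move=> _ [y [xy yx] <-]; exists (S y); first by exists y.
rewrite distrC (le_trans (ST y))// mulrAC ler_pdivrMr// ler_wpM2l ?ltW//.
rewrite (@le_lt_trans _ _ `|x|) ?ltrDl//; apply: vle_normr => //.
by rewrite vleNl.
Qed.

(** The extension is the difference of the values at the positive and negative
    parts; it equals [f u - f v] for every decomposition [u - v] with [u, v >= 0],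
    and this makes it additive. *)
Lemma cone_extension (f : E -> F) :
  (forall x y, 0 <=L x -> 0 <=L y -> f (x + y) = f x + f y) ->
  (forall (a : R) x, 0 < a -> 0 <=L x -> f (a *: x) = a *: f x) ->
  exists2 g : E -> F, linear g & forall x, 0 <=L x -> g x = f x.
Proof.
move=> fD fZ; pose g x := f (vpos x) - f (vpos (- x)).
have f0 : f 0 = 0.
  by apply: (addrI (f 0)); rewrite -fD// !addr0.
have gE u v : 0 <=L u -> 0 <=L v -> g (u - v) = f u - f v.
  move=> u0 v0.
  have : vpos (u - v) + v = u + vpos (- (u - v)).
    by rewrite -[vpos (u - v)](subrK (vpos (- (u - v)))) vposBneg addrAC subrK.
  move=> /(congr1 f); rewrite !fD// => e.
  by apply/eqP; rewrite subr_eq addrAC -e addrK.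
have gp x : 0 <=L x -> g x = f x.
  by move=> x0; rewrite -[x in LHS]subr0 gE// f0 subr0.
have gD x y : g (x + y) = g x + g y.
  rewrite -{1}[x]vposBneg -{1}[y]vposBneg addrACA -opprD.
  by rewrite gE ?vaddr_ge0// !fD// opprD addrACA.
have gN x : g (- x) = - g x by rewrite /g opprK opprB.
have gZ (a : R) x : 0 < a -> g (a *: x) = a *: g x.
  move=> a0; rewrite -{1}[x]vposBneg scalerBr gE ?vscale_ge0// ?ltW//.
  by rewrite !fZ// scalerBr.
exists g => // a x y; rewrite gD; congr (_ + _).
have [a0|a0|->] := ltgtP a 0; last by rewrite !scale0r gp.
  by rewrite -[a]opprK (scaleNr (- a)) gN gZ ?oppr_gt0// -scaleNr.
exact: gZ.
Qed.

End AMCompact.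

(** * The lattice of am-compact operators with values in an AM-space *)

Section AMRange.
Context {R : realType} {E F : banachLatticeType R}.
Hypothesis FAM : AM_space F.
Implicit Types (S T W : E -> F) (x y : E) (c : R).

Lemma itv_image_tbounded T x : am_compact T -> 0 <=L x ->
  tbounded (T @` vitv 0 x) /\ T @` vitv 0 x !=set0.
Proof.
move=> [lT _ tT] x0; split; last by exists (T 0), 0.
apply: sub_tbounded (tT x x0) => _ [y [y0 yx] <-]; exists y => //; split=> //.
by apply: (vle_tr _ y0); rewrite voppr_le0.
Qed.

(** The positive part is given by the Riesz-Kantorovich formula; its values on an
    order interval are suprema of parts of a totally bounded set. *)
Lemma am_compact_pos T : am_compact T ->
  exists2 P, am_compact P & forall x, 0 <=L x -> is_vlub (T @` vitv 0 x) (P x).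
Proof.
move=> amT; have [lT [c c0 bT] tT] := amT.
have exf x : exists p, 0 <=L x -> is_vlub (T @` vitv 0 x) p.
  have [x0|x0] := pselect (0 <=L x); last by exists 0.
  have [tI I0] := itv_image_tbounded amT x0.
  by have [p] := tbounded_vlub FAM tI I0; exists p.
have [f fP] := choice exf.
have [||P lP Pf] := @cone_extension R E F f.
- move=> x y x0 y0; apply: (vlub_uniq (fP _ (vaddr_ge0 x0 y0))).
  suff -> : T @` vitv 0 (x + y) = [set z | exists p q,
      [/\ (T @` vitv 0 x) p, (T @` vitv 0 y) q & z = p + q]].
    exact: vlubD (fP x x0) (fP y y0).
  apply/seteqP; split=> z.
    move=> [w [w0 wxy] <-].
    have [u [v [-> u0 ux v0 vy]]] := riesz_decomposition x0 y0 w0 wxy.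
    by exists (T u), (T v); split; [exists u|exists v|rewrite linD].
  move=> [_ [_ [[u [u0 ux] <-] [v [v0 vy] <-] ->]]].
  by exists (u + v); rewrite ?linD//; split; [exact: vaddr_ge0|exact: vleD].
- move=> a x a0 x0; have a0' := ltW a0.
  apply: (vlub_uniq (fP _ (vscale_ge0 _ _ a0' x0))).
  suff -> : T @` vitv 0 (a *: x) =
      [set z | exists2 p, (T @` vitv 0 x) p & z = a *: p].
    exact: vlubZ (fP x x0).
  apply/seteqP; split=> z.
    move=> [w [w0 wx] <-]; exists (T (a^-1 *: w)).
      exists (a^-1 *: w) => //; split; first by rewrite vscale_ge0// invr_ge0.
      rewrite -[x](@scalerK _ _ a) ?gt_eqF//; apply: vleZ => //.
      by rewrite invr_ge0.
    by rewrite -linZ// scalerA divff ?scale1r// gt_eqF.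
  move=> [_ [u [u0 ux] <-] ->]; exists (a *: u); rewrite ?linZ//.
  by split; [exact: vscale_ge0|exact: vleZ].
have Plub x : 0 <=L x -> is_vlub (T @` vitv 0 x) (P x).
  by move=> x0; rewrite Pf//; exact: fP.
have pP : positive P.
  by move=> x x0; apply: (vlub_ub (Plub x x0)); exists 0 => //; exact: lin0.
exists P => //; split=> //.
  exists c => //; apply: positive_bounded => // x x0.
  have [tI I0] := itv_image_tbounded amT x0.
  apply: (norm_vlub FAM tI I0 (Plub x x0)) => _ [y [y0 yx] <-].
  by rewrite (le_trans (bT y))// ler_wpM2l// vle_norm_ge0.
move=> x x0; have xx0 := vaddr_ge0 x0 x0.
have [tI _] := itv_image_tbounded amT xx0.
have tP : tbounded ((fun b => b - P x) @` [set b | exists B,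
    [/\ B `<=` T @` vitv 0 (x + x), B !=set0 & is_vlub B b]]).
  apply: (tbounded_image (ler01 : 0 <= (1 : R))) (tbounded_vlubs FAM tI) => a b.
  by rewrite mul1r opprB addrA subrK.
apply: sub_tbounded tP.
move=> _ [y [xy yx] <-]; exists (P (y + x)); last by rewrite linD// addrK.
have yx0 : 0 <=L y + x by rewrite -[y]opprK addrC vsubr_ge0 vleNl.
exists (T @` vitv 0 (y + x)); split; last exact: Plub.
- move=> _ [z [z0 zx] <-]; exists z => //; split => //.
  by apply: (vle_tr zx); exact: vleD.
- by exists (T 0), 0.
Qed.

(** The join is [T + (S - T)^+], whose value at [x >= 0] is the supremum of the
    vectors [S y + T (x - y)] with [0 <= y <= x]; the last clause keeps what this
    formula says about norms. *)
Lemma am_compact_join S T : am_compact S -> am_compact T ->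
  exists J, [/\ am_compact J,
    forall W, linear W -> (op_le J W <-> op_le S W /\ op_le T W) &
    forall x c, 0 <=L x ->
      (forall y, 0 <=L y -> y <=L x -> `|S y + T (x - y)| <= c) -> `|J x| <= c].
Proof.
move=> amS amT; have amD : am_compact (S - T).
  by rewrite addrC -scaleN1r; exact: am_compact_comb.
have [P amP Plub] := am_compact_pos amD.
have [[lS _ _] [lT _ _]] := (amS, amT).
have [[lP _ _] [lD _ _]] := (amP, amD).
exists (T + P); split.
- by rewrite -[T]scale1r; exact: am_compact_comb.
- move=> W lW; split=> [JW|[SW TW] x x0].
    split=> x x0; apply: vle_tr (JW x x0); rewrite -[(T + P) x]/(T x + P x).
      rewrite addrC -vleBlDr; apply: (vlub_ub (Plub x x0)).
      by exists x.
    apply: vleDl; apply: (vlub_ub (Plub x x0)); exists 0 => //.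
    exact: lin0.
  rewrite fctE addrC -vleBrDr; apply: (vlub_least (Plub x x0)).
  move=> _ [y [y0 yx] <-]; rewrite fctE vleBrDr.
  apply: (@vle_tr _ _ (W y + T (x - y))).
    by rewrite linB// addrAC -addrA; apply: vleD => //; exact: SW.
  have -> : W x = W y + W (x - y) by rewrite -linD// addrC subrK.
  by apply: vleD => //; apply: TW; rewrite vsubr_ge0.
- move=> x c x0 bc; have [tI [a Ia]] := itv_image_tbounded amD x0.
  pose sh (b : F) := T x + b.
  apply: (@norm_vlub _ _ FAM (sh @` ((S - T) @` vitv 0 x))).
  + apply: tbounded_image tI; first exact: ler01.
    by move=> u v; rewrite /sh opprD addrACA subrr add0r mul1r.
  + by exists (sh a), a.
  + move=> z; rewrite fctE addrC -vleBrDr; split.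
      move=> Pz _ [b Ib <-]; rewrite /sh addrC -vleBrDr.
      exact: vle_tr (vlub_ub (Plub x x0) Ib) Pz.
    move=> H; apply: (vlub_least (Plub x x0)) => b Ib.
    by rewrite vleBrDr addrC; apply: H; exists b.
  + move=> _ [_ [y [y0 yx] <-] <-]; have := bc y y0 yx.
    by rewrite /sh linB// fctE addrCA.
Qed.

(** The modulus has the same bound as the operator, which makes every am-compact
    operator regular, with regular norm equal to the operator norm. *)
Lemma am_compact_abs T : am_compact T ->
  exists A, [/\ am_compact A,
    forall W, linear W -> (op_le A W <-> op_le T W /\ op_le (- T) W) &
    op_norm A <= op_norm T].
Proof.
move=> amT; have [lT [c c0 bT] tT] := amT.
have bT' := bounded_op_norm lT c0 bT; have n0 := op_norm_ge0 c0 bT.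
have amN := am_compact_opp amT.
have [A [amA AP nA]] := am_compact_join amT amN.
exists A; split=> //; have [lA _ _] := amA.
have [TA NTA] := (AP A lA).1 (fun x _ => vlexx _).
apply: op_norm_le => //; apply: positive_bounded => //.
  by move=> x x0; exact: vge0_of_pm (TA x x0) (NTA x x0).
move=> x x0; apply: nA => // y y0 yx; rewrite fctE -linN// -linD//.
rewrite (le_trans (bT' _))// ler_wpM2l//; apply: vle_normr.
  rewrite opprB addrA vleBlDr; apply: vleD => //.
by rewrite opprD opprK addrCA -{2}[x]addr0; apply: vleD => //;
  rewrite -opprD voppr_le0 vaddr_ge0.
Qed.

End AMRange.

(** * Un-compactness of order bounded sets *)

Lemma seq_directed (T : eqType) (s t : seq T) :
  exists r : seq T, {subset s <= r} /\ {subset t <= r}.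
Proof. by exists (s ++ t); split=> x xs; rewrite mem_cat xs ?orbT. Qed.

Definition seq_directedSet (T : eqType) : directedSet :=
  @DirectedSet (seq T) (fun s t => {subset s <= t}) (fun s x xs => xs)
    (fun s t r st tr x xs => tr x (st x xs)) (inhabits [::]) (@seq_directed T).

Section UnCompact.
Context {R : realType} {F : banachLatticeType R}.
Implicit Types (A : set F) (u z : F).

(** On an order bounded set un-convergence is norm convergence, since
    [|y - z| <= u + |z|] makes the truncation at [u + |z|] invisible.  A set that
    is not totally bounded carries a net, indexed by its finite subsets [s], whose
    value at [s] stays away from [s]; no subnet of it is norm convergent. *)
Lemma un_compact_tbounded A u : (forall a, A a -> a <=L u /\ - a <=L u) ->
  un_compact A -> tbounded A.
Proof.
move=> Au cA e e0; apply: contrapT => /forallNP H.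
have far (s : seq F) : exists a, A a /\ forall b, b \in s -> e < `|a - b|.
  have /existsNP[a /not_implyP[Aa Hs]] := H s; exists a; split=> // b bs.
  by rewrite ltNge; apply/negP => abe; apply: Hs; exists b.
have [y yP] := choice far.
have [J [h [hsub [z yz]]]] := cA (seq_directedSet F) y (fun s => (yP s).1).
have [Hu Hn] : (forall j, vabs (y (h j) - z) <=L u + vabs z) /\ 0 <=L u.
  have yu s : vabs (y s) <=L u by have [] := Au _ (yP s).1; exact: vabs_le.
  split=> [j|]; last exact: vle_tr (vabs_ge0 _) (yu [::]).
  by apply: (vle_tr (vabsD _ _)); rewrite vabsN; exact: vleD.
have /cvgrPdist_lt /(_ (e / 2)) := yz (u + vabs z) (vaddr_ge0 Hn (vabs_ge0 z)).
rewrite divr_gt0// => /(_ isT)[j0 j0P].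
have near_z j : dset_le j0 j -> `|y (h j) - z| < e / 2.
  move=> /j0P; rewrite sub0r normrN normr_id /= vmeet_idl// norm_vabs.
  by [].
have [j1 j1P] : (h @ net_tails J) [set t : seq F | y (h j0) \in t].
  apply: hsub; exists [:: y (h j0)] => t /(_ (y (h j0))); apply.
  exact: mem_head.
have [k [j0k j1k]] := dset_directed j0 j1.
have := (yP (h k)).2 _ (j1P k j1k); apply/negP; rewrite -leNgt.
rewrite -(subrKA z) (le_trans (ler_normD _ _))// [leRHS]splitr lerD//.
  exact/ltW/near_z.
by rewrite distrC; exact/ltW/near_z/dset_refl.
Qed.

Lemma ultra_finite_union (U : set_system F) (B : F -> set F) (s : seq F) :
  UltraFilter U -> U [set x | exists2 b, b \in s & B b x] ->
  exists b, U (B b).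
Proof.
move=> UU; elim: s => [|b s IH] Us.
  by have [x []] := filter_ex Us.
have [Ub|Ub] := in_ultra_setVsetC (B b) UU; first by exists b.
apply: IH; apply: filterS (filterI Us Ub) => x [[c]].
by rewrite inE => /predU1P[->|cs] Bx nb; [|exists c].
Qed.

(** An ultrafilter on a totally bounded set is Cauchy, because one of finitely many
    small balls belongs to it; its limit is a cluster point of the net. *)
Lemma tbounded_cluster A (I : directedSet) (y : I -> F) :
  tbounded A -> (forall i, A (y i)) ->
  exists z, forall (e : R) i, 0 < e -> exists2 j, dset_le i j & `|y j - z| < e.
Proof.
move=> tA Ay.
have [U [UU yU]] := ultraFilterLemma (fmap_proper_filter y (net_tails_filter I)).
have UA : U A by apply: yU; have [i] := dset_inhabited I; exists i => j _ /=.
have /cauchy_cvgP Ucvg : cauchy U.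
  apply: cauchy_exP => e e0; have e20 : 0 < e / 2 by rewrite divr_gt0.
  have [s sA] := tA _ e20.
  have [|b Ub] := @ultra_finite_union U (fun b => [set a | `|a - b| <= e / 2]) s UU.
    by apply: filterS UA => a /sA[b bs ab]; exists b.
  exists b; apply: filterS Ub => a /= ab; rewrite -ball_normE /= distrC.
  by rewrite (le_lt_trans ab)// gtr_pMr// invf_lt1// ltr1n.
exists (lim U) => e i e0.
have Ue : U (ball (lim U) e) by apply: Ucvg; exact: nbhsx_ballx.
have Ui : U [set y j | j in dset_le i] by apply: yU; exists i => j ij; exists j.
have [x [zx [j ij yx]]] := filter_ex (filterI Ue Ui).
by exists j => //; rewrite yx; move: zx; rewrite -ball_normE /= distrC.
Qed.

(** The subnet that converges to a cluster point [z] is indexed by the pairs [(i, n)]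
    with [y i] closer to [z] than [1 / (n + 1)].  Norm convergence implies
    un-convergence. *)
Lemma tbounded_un_compact A : tbounded A -> un_compact A.
Proof.
move=> tA I y Ay; have [z zP] := tbounded_cluster tA Ay.
pose JT := {p : I * nat | `|y p.1 - z| < p.2.+1%:R^-1}.
pose Jle (p q : JT) := dset_le (sval p).1 (sval q).1 /\ ((sval p).2 <= (sval q).2)%N.
have above i n : exists p : JT, dset_le i (sval p).1 /\ (n <= (sval p).2)%N.
  have [|j ij yz] := zP (n.+1%:R^-1) i; first by rewrite invr_gt0.
  by exists (exist _ (j, n) yz).
have Jrefl p : Jle p p by split; [exact: dset_refl|].
have Jtrans p q r : Jle p q -> Jle q r -> Jle p r.
  by move=> [pq1 pq2] [qr1 qr2]; split; [exact: dset_trans qr1|exact: leq_trans qr2].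
have Jinh : inhabited JT.
  by have [i] := dset_inhabited I; have [p _] := above i 0%N; exact: inhabits p.
have Jdir p q : exists r, Jle p r /\ Jle q r.
  have [k [pk qk]] := dset_directed (sval p).1 (sval q).1.
  have [r [kr nr]] := above k (maxn (sval p).2 (sval q).2).
  move: nr; rewrite geq_max => /andP[pr qr].
  by exists r; split; split=> //; exact: dset_trans kr.
exists (DirectedSet Jrefl Jtrans Jinh Jdir), (fun p => (sval p).1); split.
  move=> B [i0 i0B]; have [p [ip _]] := above i0 0%N.
  by exists p => q [pq _]; apply: i0B; exact: dset_trans pq.
exists z => u u0; apply/cvgrPdist_lt => e e0.
have [N _ dN] : \forall n \near \oo, n.+1%:R^-1 < e.
  have /cvgrPdist_lt /(_ _ e0) := @cvg_harmonic R.
  by apply: filterS => n; rewrite sub0r normrN gtr0_norm// invr_gt0.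
have [i] := dset_inhabited I; have [p [_ Np]] := above i N.
exists p => q [_ pq] /=; rewrite sub0r normrN normr_id.
have m0 : 0 <=L vmeet (vabs (y (sval q).1 - z)) u by exact: vleI.
rewrite (le_lt_trans (vle_norm_ge0 m0 (vleIl _ _)))// norm_vabs.
by rewrite (lt_trans (svalP q))// dN//=; exact: leq_trans pq.
Qed.

End UnCompact.

Section Regular.
Context {R : realType} {E F : banachLatticeType R}.
Implicit Types (S T : E -> F).

Lemma am_compact_K_AMun T : am_compact T -> K_AMun T.
Proof.
move=> [lT bT tT]; split=> //; first exact/continuous_boundedP.
by move=> x x0; apply: tbounded_un_compact; exact: tT.
Qed.

(** Domination makes the images of order intervals order bounded. *)
Lemma K_AMun_am_compact S T : K_AMun T -> linear S -> op_le T S -> op_le (- T) S ->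
  am_compact T.
Proof.
move=> [lT cT uT] lS TS NTS; split=> //; first exact/(continuous_boundedP lT).
move=> x x0; apply: (@un_compact_tbounded _ _ _ (S x)) (uT x x0).
have pS : positive S by move=> v v0; exact: vge0_of_pm (TS v v0) (NTS v v0).
move=> _ [y [xy yx] <-].
have step U : linear U -> op_le U S -> op_le (- U) S -> U y <=L S x.
  move=> lU US NUS.
  (* [2 U y = U (x + y) - U (x - y) <= S (x + y) + S (x - y) = 2 S x] *)
  rewrite -[U y]scaler_half -[S x]scaler_half; apply: vleZ; first by rewrite invr_ge0.
  have -> : U y + U y = U (x + y) + (- U) (x - y).
    rewrite fctE -linN// opprB -(linD lU y) -(linD lU (x + y)); congr U.
    by rewrite [RHS]addrC addrA subrK.
  have -> : S x + S x = S (x + y) + S (x - y).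
    by rewrite -(linD lS x) -(linD lS (x + y)) addrACA subrr addr0.
  apply: vleD; first by apply: US; rewrite -[y]opprK vsubr_ge0 vleNl.
  by apply: NUS; rewrite vsubr_ge0.
split; first exact: step.
by apply: (step (- T)); rewrite ?opprK//; exact: lin_opp.
Qed.

Lemma Kpos_am_compact S : Kpos_AMun S -> am_compact S /\ positive S.
Proof.
move=> [KS S0]; have [lS _ _] := KS.
have pS : positive S by move=> x x0; exact: S0.
split=> //; apply: (K_AMun_am_compact KS lS) => x x0 //.
by apply: (@vle_tr _ _ 0); [rewrite fctE voppr_le0|]; exact: pS.
Qed.

Lemma am_compact_Kpos S : am_compact S -> positive S -> Kpos_AMun S.
Proof. by move=> amS pS; split; [exact: am_compact_K_AMun|move=> x; exact: pS]. Qed.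

Lemma Kr_am_compact T : Kr_AMun E F T -> am_compact T.
Proof.
move=> [KT [S [/Kpos_am_compact[[lS _ _] _] TS NTS]]].
exact: K_AMun_am_compact KT lS TS NTS.
Qed.

Lemma dominating_op_norm S T : am_compact T -> Kpos_dominating T S ->
  op_norm T <= op_norm S.
Proof.
move=> [lT _ _] [/Kpos_am_compact[[lS [c c0 bS] _] _] TS NTS].
apply: op_norm_le; first exact: op_norm_ge0 bS.
move=> x; rewrite (le_trans (dominated_norm _ lS lT TS NTS))//.
by rewrite (le_trans (bounded_op_norm lS c0 bS _))// norm_vabs.
Qed.

(** Dominating operators have larger operator norm, so the infimum that defines the
    AM-un-norm is attained at a dominating [S] whose operator norm is that of [T]. *)
Lemma AMun_normE S T : am_compact T -> Kpos_dominating T S ->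
  op_norm S <= op_norm T -> AMun_norm T = op_norm T.
Proof.
move=> amT ST nST.
have lbT : lbound [set op_norm S | S in Kpos_dominating T] (op_norm T).
  by move=> _ [S' /(dominating_op_norm amT) ? <-].
apply/eqP; rewrite eq_le; apply/andP; split.
  apply: (@le_trans _ _ (op_norm S)) => //.
  by apply: ge_inf; [exists (op_norm T)|exists S].
by apply: lb_le_inf => //; exists (op_norm S), S.
Qed.

End Regular.

(** * The Banach space of am-compact operators *)

Section AMOp.
Context {R : realType} (E F : banachLatticeType R).

Definition am_compact_mem : {pred (E -> F)} := fun T => `[< am_compact T >].

Lemma am_compact_submod : submod_closed am_compact_mem.
Proof.
split; first exact/asboolP/am_compact0.
by move=> a S T /asboolP amS /asboolP amT; exact/asboolP/am_compact_comb.
Qed.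

HB.instance Definition _ := GRing.isSubmodClosed.Build _ _ am_compact_mem
  am_compact_submod.

(** The carrier of the Banach lattice.  Its norm and completeness make sense for all
    [E] and [F]; its order is a lattice order when [F] is an AM-space. *)
Record amop := AMOp {
  amop_fun :> E -> F ;
  amop_subproof : amop_fun \in am_compact_mem
}.

HB.instance Definition _ := [isSub for amop_fun].
HB.instance Definition _ := [Choice of amop by <:].
HB.instance Definition _ := [SubChoice_isSubLmodule of amop by <:].

Lemma amopP (T : amop) : am_compact (T : E -> F).
Proof. exact/asboolP/amop_subproof. Qed.

Lemma amop_bounded (T : amop) : bounded_by (op_norm T) T.
Proof. by have [lT [c c0 bT] _] := amopP T; exact: bounded_op_norm bT. Qed.

Lemma op_norm_amop_ge0 (T : amop) : 0 <= op_norm T.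
Proof. by have [_ [c c0 bT] _] := amopP T; exact: op_norm_ge0 bT. Qed.

Let norm (T : amop) := op_norm T.

Let norm_triangle (S T : amop) : norm (S + T) <= norm S + norm T.
Proof.
apply: op_norm_le; first by rewrite addr_ge0// op_norm_amop_ge0.
move=> x; rewrite mulrDl (le_trans (ler_normD _ _))// lerD//;
  exact: amop_bounded.
Qed.

Let norm_scale_le (a : R) (T : amop) : norm (a *: T) <= `|a| * norm T.
Proof.
apply: op_norm_le; first by rewrite mulr_ge0// op_norm_amop_ge0.
by move=> x; rewrite normrZ -mulrA ler_wpM2l// amop_bounded.
Qed.

Let norm_scale (a : R) (T : amop) : norm (a *: T) = `|a| * norm T.
Proof.
apply/eqP; rewrite eq_le norm_scale_le andTb.
have [->|a0] := eqVneq a 0; first by rewrite normr0 mul0r op_norm_amop_ge0.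
rewrite -{1}[T](scalerK a0) -ler_pdivlMl ?normr_gt0//.
by rewrite (le_trans (norm_scale_le _ _))// normfV.
Qed.

Let norm0_eq0 (T : amop) : norm T = 0 -> T = 0.
Proof.
move=> T0; apply/val_inj/funext => x; apply/eqP; rewrite -normr_le0.
by rewrite (le_trans (amop_bounded T x))// [op_norm _]T0 mul0r.
Qed.

HB.instance Definition _ := Lmodule_isNormed.Build R amop
  norm_triangle norm_scale norm0_eq0.

Lemma amop_le (T : amop) x : `|T x| <= `|T| * `|x|.
Proof. exact: amop_bounded. Qed.

(** The limit of a Cauchy filter is the pointwise limit, which is approached
    uniformly on the unit ball. *)
Lemma amop_complete (G : set_system amop) : ProperFilter G -> cauchy G -> cvg G.
Proof.
move=> GG /cauchyP Gc.
have evc x : cvg ((fun S : amop => S x) @ G).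
  apply/cauchy_cvgP/cauchy_exP => e e0.
  have n0 : 0 < `|x| + 1 by rewrite ltr_wpDl.
  have [S GS] := Gc _ (divr_gt0 e0 n0).
  exists (S x); suff : G [set S' : amop | ball (S x) e (S' x)] by [].
  apply: filterS GS => S'; rewrite -!ball_normE /= => SS'.
  rewrite (le_lt_trans (amop_le (S - S') x))//.
  apply: (@le_lt_trans _ _ (e / (`|x| + 1) * `|x|)).
    by rewrite ler_wpM2r// ltW.
  by rewrite mulrAC ltr_pdivrMr// ltr_pM2l// ltrDl.
pose T x := lim ((fun S : amop => S x) @ G).
have evT x : (fun S : amop => S x) @ G --> T x by exact: evc.
have lT : linear T.
  move=> a x y; apply: cvg_lim => //.
  have -> : (fun S : amop => S (a *: x + y)) = (fun S : amop => a *: S x + S y).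
    by apply/funext => S; have [lS _ _] := amopP S; exact: lS.
  by apply: cvgD => //; exact: cvgZr.
have bT e (S : amop) : G (ball S e) -> bounded_by e ((S : E -> F) - T).
  move=> GS x; apply/ler_addgt0Pr => d d0.
  have Gx : G [set S' : amop | `|T x - S' x| < d].
    by move/cvgrPdist_lt : (evT x); exact.
  have [S' [SS' xS']] := filter_ex (filterI GS Gx).
  have -> : ((S : E -> F) - T) x = (S x - S' x) + (S' x - T x) by rewrite subrKA.
  rewrite (le_trans (ler_normD _ _))// lerD//; last by rewrite distrC ltW.
  by rewrite (le_trans (amop_le (S - S') x))// ler_wpM2r// ltW//.
have amT : am_compact T.
  apply: am_compact_limit => // e e0; have [S /bT] := Gc e e0.
  by exists S => //; exact: amopP.
have Tmem : T \in am_compact_mem by exact/asboolP.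
pose T' := AMOp Tmem.
apply/cvg_ex; exists T'; apply/cvgrPdist_le => e e0.
have [S0 GS0] := Gc (e / 2) (divr_gt0 e0 (ltr0n R 2)).
near=> S; rewrite distrC; apply: op_norm_le; first exact: ltW.
apply: bT; apply: (filterS _ GS0) => S1; rewrite -!ball_normE /= => S01.
rewrite -(subrKA S0) (le_lt_trans (ler_normD _ _))// [ltRHS]splitr ltrD//.
rewrite distrC; near: S; apply: (filterS _ GS0) => S2.
by rewrite -ball_normE.
Unshelve. all: by end_near. Qed.

HB.instance Definition _ := Uniform_isComplete.Build amop amop_complete.

End AMOp.


(** * Operators from an AL-space to an AM-space *)

Section Sufficiency.
Context {R : realType} {E F : banachLatticeType R}.
Hypothesis FAM : AM_space F.
Implicit Types (S T W : amop E F) (x y : E) (c : R).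

Let ole : rel (amop E F) := fun S T => `[< op_le S T >].

Let oleP S T : reflect (op_le S T) (ole S T). Proof. exact: asboolP. Qed.

Lemma amop_linear T : linear T. Proof. by have [] := amopP T. Qed.

Lemma amop_dominating T : exists A : amop E F,
  [/\ forall W, op_le A W <-> op_le T W /\ op_le (- T) W,
      Kpos_dominating T A & `|A| <= `|T|].
Proof.
have [A [amA AP nA]] := am_compact_abs FAM (amopP T).
have Amem : A \in @am_compact_mem R E F by exact/asboolP.
have [lA _ _] := amA; have [TA NTA] := (AP A lA).1 (fun x _ => vlexx _).
exists (AMOp Amem); split=> // [W|].
  by apply: AP; exact: amop_linear.
split=> //; apply: am_compact_Kpos => // x x0.
exact: vge0_of_pm (TA x x0) (NTA x x0).
Qed.

Lemma amop_Kr T : Kr_AMun E F T.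
Proof.
split; first exact/am_compact_K_AMun/amopP.
by have [A [_ TA _]] := amop_dominating T; exists A.
Qed.

Lemma amop_AMun_norm T : AMun_norm T = `|T|.
Proof.
have [A [_ TA nA]] := amop_dominating T.
exact: AMun_normE (amopP T) TA nA.
Qed.

Let join_spec S T J := (forall W, ole J W = ole S W && ole T W) /\
  (forall x c, 0 <=L x ->
    (forall y, 0 <=L y -> y <=L x -> `|S y + T (x - y)| <= c) -> `|J x| <= c).

Let join_ex (p : amop E F * amop E F) : exists J, join_spec p.1 p.2 J.
Proof.
case: p => S T /=.
have [J [amJ JW nJ]] := am_compact_join FAM (amopP S) (amopP T).
have Jmem : J \in @am_compact_mem R E F by exact/asboolP.
exists (AMOp Jmem); split=> // W; apply/idP/andP.
  by move=> /oleP /JW[]; [exact: amop_linear|split; exact/oleP].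
by move=> [/oleP SW /oleP TW]; apply/oleP/JW => //; exact: amop_linear.
Qed.

(** The lattice operations are obtained by choice from the existence of joins;
    the norm bound of [join_spec] is what makes the norm an AM-norm. *)
Lemma AM_space_sufficient : AL_space E ->
  is_AM_space_under (Kr_AMun E F) op_le AMun_norm.
Proof.
move=> EAL; have [jn jnP] := choice join_ex.
pose join S T := jn (S, T); pose meet S T := - join (- S) (- T).
have joinP S T W : ole (join S T) W = ole S W && ole T W.
  by have [] := jnP (S, T).
have ole_refl : reflexive ole by move=> S; apply/oleP => x x0; exact: vlexx.
have ole_anti : antisymmetric ole.
  move=> S T /andP[/oleP ST /oleP TS]; apply/val_inj/funext => x /=.
  have ST_pos y : 0 <=L y -> S y = T y by move=> y0; apply: vle_asym; auto.
  have [lS lT] := (amop_linear S, amop_linear T).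
  by rewrite -[x]vposBneg (linB lS) (linB lT) !ST_pos.
have ole_trans : transitive ole.
  move=> T S W /oleP ST /oleP TW; apply/oleP => x x0.
  exact: vle_tr (ST x x0) (TW x x0).
have oleN S T : ole (- S) (- T) = ole T S.
  by apply/oleP/oleP => H x x0; have := H x x0; rewrite vleN.
have meetP S T W : ole W (meet S T) = ole W S && ole W T.
  by rewrite /meet -{1}[W]opprK oleN joinP !oleN.
have oleD W S T : ole S T -> ole (S + W) (T + W).
  by move=> /oleP ST; apply/oleP => x x0; rewrite vleDr; exact: ST.
have ole_scale (a : R) S : 0 <= a -> ole 0 S -> ole 0 (a *: S).
  by move=> a0 /oleP S0; apply/oleP => x x0; apply: vscale_ge0 => //; exact: S0.
have ole_norm S T : ole (join S (- S)) (join T (- T)) -> `|S| <= `|T|.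
  move=> ST; have [A [AP [KA TA NTA] nA]] := amop_dominating T.
  apply: le_trans nA; apply: dominating_op_norm; first exact: amopP.
  have : ole (join S (- S)) A.
    by apply: ole_trans ST _; rewrite joinP; apply/andP; split; exact/oleP.
  by rewrite joinP => /andP[/oleP SA /oleP NSA]; split.
pose mix := isBanachLattice.Build R (amop E F) ole_refl ole_anti ole_trans
  joinP meetP oleD ole_scale ole_norm.
pose X : banachLatticeType R := HB.pack (amop E F) mix.
have phiL : linear (@amop_fun R E F : X -> (E -> F)) by [].
pose lin := GRing.isLinear.Build R X (E -> F) *:%R _ phiL.
pose phi : {linear X -> (E -> F)} := HB.pack (@amop_fun R E F : X -> (E -> F)) lin.
exists X, phi; split.
- split=> [T _|S T _ _|T KT].
  + exact: amop_Kr.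
  + exact: val_inj.
  + have Tmem : T \in @am_compact_mem R E F by apply/asboolP; exact: Kr_am_compact KT.
    by exists (AMOp Tmem).
- by move=> S T; split=> [/oleP|/oleP].
- by move=> T; rewrite amop_AMun_norm.
- move=> S T S0 T0.
  have Sp : op_le 0 S by exact: (elimT (oleP 0 S) S0).
  have Tp : op_le 0 T by exact: (elimT (oleP 0 T) T0).
  have [SJ TJ] : op_le S (join S T) /\ op_le T (join S T).
    by have := ole_refl (join S T); rewrite joinP => /andP[/oleP ? /oleP ?].
  have Jp : op_le 0 (join S T) by move=> x x0; exact: vle_tr (Sp x x0) (SJ x x0).
  have KJ : Kpos_AMun (join S T).
    by apply: am_compact_Kpos => //; exact: amopP.
  have le_join (U : amop E F) : op_le 0 U -> op_le U (join S T) -> `|U| <= `|join S T|.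
    move=> U0 UJ; apply: dominating_op_norm; first exact: amopP.
    split=> // x x0; apply: (@vle_tr _ _ 0); last exact: Jp.
    by rewrite fctE voppr_le0; exact: U0.
  apply/eqP; rewrite eq_le; apply/andP; split; last first.
    by rewrite ge_max; apply/andP; split; exact: le_join.
  have m0 : 0 <= Num.max `|S| `|T| by rewrite le_max normr_ge0.
  apply: op_norm_le => //; apply: positive_bounded; first exact: amop_linear.
    exact: Jp.
  move=> x x0; have [_ nJ] := jnP (S, T); apply: nJ => // y y0 yx /=.
  have xy0 : 0 <=L x - y by rewrite vsubr_ge0.
  rewrite (le_trans (ler_normD _ _))// -[x in leRHS](subrK y) addrC EAL//.
  rewrite mulrDr lerD//.
    by rewrite (le_trans (amop_le T _))// ler_wpM2r// le_max lexx orbT.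
  by rewrite (le_trans (amop_le S y))// ler_wpM2r// le_max lexx.
Qed.

End Sufficiency.

(** * Hahn-Banach *)

Section HahnBanach.
Context {R : realType} {V : lmodType R}.
Implicit Types (p q r : V -> R) (x y : V).

(** For positive [a] one inequality suffices: applied to [a^-1], it gives the other. *)
Definition sublinear p := (forall x y, p (x + y) <= p x + p y) /\
  (forall (a : R) x, 0 < a -> p (a *: x) <= a * p x) /\ p 0 = 0.

Lemma sublinearZ p (a : R) x : sublinear p -> 0 <= a -> p (a *: x) = a * p x.
Proof.
move=> [_ [pZ p0]]; rewrite le_eqVlt => /predU1P[<-|a0].
  by rewrite scale0r mul0r.
apply/eqP; rewrite eq_le pZ//= -ler_pdivlMl//.
by rewrite -{1}[x](@scalerK _ _ a) ?gt_eqF// pZ// invr_gt0.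
Qed.

Lemma sublinearN p x : sublinear p -> - p (- x) <= p x.
Proof. by move=> [pD [_ p0]]; have := pD x (- x); rewrite subrr p0; lra. Qed.

(** The infimum of [q (x + t y) - t q y] over [t >= 0] is the largest sublinear
    functional below [q] whose value at [- y] is at most [- q y]. *)
Lemma sublinear_lower q y : sublinear q ->
  exists q', [/\ sublinear q', forall x, q' x <= q x & q' (- y) <= - q y].
Proof.
move=> sq; have [qD [qZ q0]] := sq.
pose v x (t : R) := q (x + t *: y) - t * q y.
pose A x := [set v x t | t in [set t : R | 0 <= t]].
have v_ge x t : 0 <= t -> - q (- x) <= v x t.
  move=> t0; have := qD (x + t *: y) (- x).
  by rewrite addrAC subrr add0r sublinearZ// /v; lra.
have hA x : has_inf (A x).
  split; first by exists (v x 0), 0 => //=.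
  by exists (- q (- x)) => _ [t /= t0 <-]; exact: v_ge.
have Ale x t : 0 <= t -> inf (A x) <= v x t.
  by move=> t0; apply: ge_inf; [exact: (hA x).2|exists t].
have leA x (b : R) : (forall t, 0 <= t -> b <= v x t) -> b <= inf (A x).
  by move=> H; apply: lb_le_inf; [exact: (hA x).1|move=> _ [t /= t0 <-]; exact: H].
exists (fun x => inf (A x)); split.
- split=> [x x'|].
    rewrite -lerBlDl; apply: (leA) => t t0; rewrite lerBlDl -lerBlDr.
    apply: (leA) => s s0; rewrite lerBlDr.
    apply: (le_trans (Ale _ _ (addr_ge0 s0 t0))).
    have := qD (x + s *: y) (x' + t *: y).
    by rewrite /v addrACA -scalerDl; lra.
  split=> [a x a0|].
    rewrite -ler_pdivrMl//; apply: (leA) => t t0; rewrite ler_pdivrMl//.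
    apply: (le_trans (Ale _ (a * t) _)); first by rewrite mulr_ge0// ltW.
    by rewrite /v -scalerA -scalerDr (sublinearZ _ sq (ltW a0)) mulrBr mulrA.
  apply/eqP; rewrite eq_le; apply/andP; split.
    by apply: (le_trans (Ale _ 0 _)) => //; rewrite /v scale0r addr0 q0; lra.
  by apply: (leA) => t t0; rewrite /v add0r sublinearZ// subrr.
- by move=> x; apply: (le_trans (Ale _ 0 _)) => //; rewrite /v scale0r addr0; lra.
- apply: (le_trans (Ale _ 1 _)) => //.
  by rewrite /v scale1r addNr q0; lra.
Qed.

(** Zorn's lemma applies because the sublinear functionals below [p] are bounded below
    at [x] by [- p (- x)], so that the pointwise infimum of a chain exists. *)
Lemma sublinear_minimal p : sublinear p ->
  exists q, [/\ sublinear q, forall x, q x <= p x &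
    forall r, sublinear r -> (forall x, r x <= q x) -> r = q].
Proof.
move=> sp; pose T := {q | sublinear q /\ forall x, q x <= p x}.
pose le_ (s t : T) := `[< forall x, sval t x <= sval s x >].
have [|||C Ctot|[q [sq qp]] qmin] := @Zorn T le_.
- by move=> t; exact/asboolP.
- move=> r s t /asboolP rs /asboolP st; apply/asboolP => x.
  exact: le_trans (st x) (rs x).
- move=> [s sP] [t tP] /asboolP /= st /asboolP /= ts; apply: eq_exist.
  by apply/funext => x; apply/eqP; rewrite eq_le ts st.
- have [[c Cc]|C0] := pselect (C !=set0); last first.
    exists (exist _ p (conj sp (fun x => lexx (p x)))) => s Cs.
    by exfalso; apply: C0; exists s.
  pose A x := [set sval s x | s in C].
  have s_ge (s : T) x : - p (- x) <= sval s x.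
    case: s => s [ss sp'] /=; apply: le_trans (sublinearN x ss).
    by rewrite lerN2.
  have hA x : has_inf (A x).
    split; first by exists (sval c x), c.
    by exists (- p (- x)) => _ [s _ <-]; exact: s_ge.
  have Ale s x : C s -> inf (A x) <= sval s x.
    by move=> Cs; apply: ge_inf; [exact: (hA x).2|exists s].
  have leA x (b : R) : (forall s, C s -> b <= sval s x) -> b <= inf (A x).
    by move=> H; apply: lb_le_inf; [exact: (hA x).1|move=> _ [s Cs <-]; exact: H].
  pose q x := inf (A x).
  have sq : sublinear q.
    split=> [x y|].
      rewrite -lerBlDl; apply: (leA) => s Cs; rewrite lerBlDl -lerBlDr.
      apply: (leA) => t Ct; rewrite lerBlDr.
      have [/asboolP st|/asboolP st] := Ctot s t Cs Ct.
        apply: (le_trans (Ale t _ Ct)); have [[tD _] _] := svalP t.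
        by apply: (le_trans (tD x y)); rewrite lerD2l; exact: st.
      apply: (le_trans (Ale s _ Cs)); have [[sD _] _] := svalP s.
      by apply: (le_trans (sD x y)); rewrite lerD2r; exact: st.
    split=> [a x a0|].
      rewrite -ler_pdivrMl//; apply: (leA) => s Cs; rewrite ler_pdivrMl//.
      apply: (le_trans (Ale s _ Cs)); have [[_ [sZ _]] _] := svalP s.
      exact: sZ.
    have s0 (s : T) : sval s 0 = 0 by have [[_ [_ ->]] _] := svalP s.
    apply/eqP; rewrite eq_le; apply/andP; split.
      by apply: (le_trans (Ale c _ Cc)); rewrite s0.
    by apply: (leA) => s _; rewrite s0.
  have qp x : q x <= p x.
    by apply: (le_trans (Ale c x Cc)); have [_] := svalP c; exact.
  by exists (exist _ q (conj sq qp)) => s Cs; apply/asboolP => x /=; exact: Ale.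
- exists q; split=> // r sr rq.
  have rp x : r x <= p x by exact: le_trans (rq x) (qp x).
  by have /(congr1 sval) := qmin (exist _ r (conj sr rp)) (introT (asboolP _) rq).
Qed.

(** A minimal sublinear functional is odd, since it cannot be lowered along any ray;
    odd sublinear functionals are linear.  Lowering [p] along the ray of [x0] first
    forces the value [p x0] at [x0]. *)
Lemma hahn_banach p x0 : sublinear p ->
  exists f, [/\ forall (a : R) x y, f (a *: x + y) = a * f x + f y,
    forall x, f x <= p x & f x0 = p x0].
Proof.
move=> sp; have [p' [sp' p'p p'x0]] := sublinear_lower x0 sp.
have [f [sf fp' fmin]] := sublinear_minimal sp'.
have [fD _] := sf.
have fN y : f (- y) = - f y.
  have [f' [sf' f'f f'y]] := sublinear_lower y sf.
  move: f'y; rewrite (fmin f')// => fy.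
  by have := sublinearN y sf; lra.
have fadd x y : f (x + y) = f x + f y.
  by have := fD x y; have := fD (x + y) (- y); rewrite addrK fN; lra.
exists f; split=> [a x y|x|].
- rewrite fadd; congr (_ + _); have [a0|a0] := leP 0 a; first exact: sublinearZ.
  rewrite -[a]opprK (scaleNr (- a)) fN sublinearZ ?oppr_ge0 ?(ltW a0)//.
  by rewrite -mulNr.
- exact: le_trans (fp' x) (p'p x).
- apply/eqP; rewrite eq_le; apply/andP; split.
    exact: le_trans (fp' x0) (p'p x0).
  by rewrite -lerN2 -fN; exact: le_trans (fp' (- x0)) p'x0.
Qed.

End HahnBanach.

(** * Positive rank one operators *)

Section RankOne.
Context {R : realType} {E F : banachLatticeType R}.
Implicit Types (f : E -> R) (x : E) (y : F).

Definition pos_contraction f := [/\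
  forall (a : R) x x', f (a *: x + x') = a * f x + f x',
  forall x, 0 <=L x -> 0 <= f x & forall x, `|f x| <= `|x|].

(** The sublinear functional [x |-> |x^+|] dominates exactly the positive
    functionals of norm at most one. *)
Lemma norming_functional x0 : 0 <=L x0 ->
  exists2 f, pos_contraction f & f x0 = `|x0|.
Proof.
move=> x00; pose p (x : E) : R := `|vpos x|.
have sp : sublinear p.
  split=> [x y|].
    rewrite /p (le_trans _ (ler_normD _ _))//; apply: vle_norm_ge0 => //.
    by apply: vleU; [exact: vleD|exact: vaddr_ge0].
  split=> [a x a0|]; last by rewrite /p vpos_id ?normr0.
  rewrite /p -[X in X * _]gtr0_norm// -normrZ; apply: vle_norm_ge0 => //.
  by apply: vleU; [apply: vleZ => //|apply: vscale_ge0 => //]; exact: ltW.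
have [f [lf fp fx0]] := hahn_banach x0 sp.
have fN x : f (- x) = - f x.
  have f0 : f 0 = 0 by have := lf 1 0 0; rewrite scale1r addr0; lra.
  by have := lf (-1) x 0; rewrite scaleN1r addr0 f0; lra.
exists f; last by rewrite fx0 /p vpos_id.
split=> // [x x0'|x].
  by have := fp (- x); rewrite fN /p vpos_le0 ?voppr_le0// normr0; lra.
rewrite ler_norml; apply/andP; split; last exact: le_trans (fp x) (norm_vpos x).
by rewrite lerNl -fN -[`|x|]normrN; exact: le_trans (fp _) (norm_vpos _).
Qed.

Lemma tbounded_interval (c : R) : tbounded [set r : R^o | `|r| <= c].
Proof.
move=> e e0; pose n := (Num.truncn (2 * c / e)).+1.
exists [seq k%:R * e - c | k <- iota 0 n] => r0; set r : R := r0 => r0c.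
have : `|r| <= c by [].
rewrite ler_norml => /andP[cr rc]; pose k := Num.truncn ((r + c) / e).
have rc0 : 0 <= (r + c) / e by apply: divr_ge0; [lra|exact: ltW].
have /andP[] := truncn_itv rc0; rewrite -/k ler_pdivlMr// ltr_pdivrMr// => k1 k2.
exists (k%:R * e - c).
  apply/mapP; exists k => //; rewrite mem_iota /= add0n ltnS.
  apply: le_truncn.
  by rewrite ler_pM2r ?invr_gt0//; lra.
rewrite ler_norml; apply/andP; split; first by lra.
by move: k2; rewrite -natr1; lra.
Qed.

Definition rank_one f y : E -> F := fun x => f x *: y.

Lemma am_compact_rank_one f y : pos_contraction f -> am_compact (rank_one f y).
Proof.
move=> [lf pf bf]; split.
- by move=> a x x'; rewrite /rank_one lf scalerDl scalerA.
- by exists `|y| => // x; rewrite normrZ mulrC ler_wpM2l.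
move=> x x0; have tI := @tbounded_image R _ _ (fun r : R^o => r *: y) `|y|
  _ (normr_ge0 y) _ (tbounded_interval `|x|).
apply: sub_tbounded (tI _); last first.
  by move=> a b; rewrite -scalerBl normrZ mulrC.
move=> _ [z [xz zx] <-]; exists (f z) => //=; rewrite (le_trans (bf z))//.
by apply: vle_normr => //; rewrite vleNl.
Qed.

Lemma rank_one_Kpos f y : pos_contraction f -> 0 <=L y -> Kpos_AMun (rank_one f y).
Proof.
move=> pf y0; apply: am_compact_Kpos; first exact: am_compact_rank_one.
by move=> x x0; apply: vscale_ge0 => //; have [_ + _] := pf; exact.
Qed.

Lemma rank_one_norm_le f y : pos_contraction f -> op_norm (rank_one f y) <= `|y|.
Proof.
move=> [_ _ bf]; apply: op_norm_le => // x.
by rewrite normrZ mulrC ler_wpM2l.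
Qed.

Lemma rank_one_norm f y x0 : pos_contraction f -> f x0 = `|x0| -> x0 != 0 ->
  op_norm (rank_one f y) = `|y|.
Proof.
move=> pf fx0 x00; apply/eqP; rewrite eq_le rank_one_norm_le//=.
have [lT [c c0 bT] _] := am_compact_rank_one y pf.
have := bounded_op_norm lT c0 bT x0; rewrite /rank_one fx0 normrZ normr_id mulrC.
by rewrite ler_pM2r// normr_gt0.
Qed.

Lemma Kpos_dominating_self (T : E -> F) : Kpos_AMun T -> Kpos_dominating T T.
Proof.
move=> KT; split=> // x x0 //; have T0 := KT.2 x x0.
by apply: (@vle_tr _ _ 0) => //; rewrite fctE voppr_le0.
Qed.

Lemma AMun_norm_Kpos (T : E -> F) : Kpos_AMun T -> AMun_norm T = op_norm T.
Proof.
move=> KT; apply: AMun_normE (Kpos_dominating_self KT) (lexx _).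
by have [] := Kpos_am_compact KT.
Qed.

Lemma Kpos_Kr (T : E -> F) : Kpos_AMun T -> Kr_AMun E F T.
Proof. by move=> KT; split; [exact: KT.1|exists T; exact: Kpos_dominating_self]. Qed.

End RankOne.

(** * Recovering the domain and the codomain *)

Lemma exists_vpos_neq0 {R : realType} (E : banachLatticeType R) :
  (exists x : E, x != 0) -> exists2 x : E, 0 <=L x & x != 0.
Proof.
move=> [x x0]; exists (vabs x); first exact: vabs_ge0.
by rewrite -normr_gt0 norm_vabs normr_gt0.
Qed.

Section Necessity.
Context {R : realType} {E F : banachLatticeType R}.
Hypotheses (E_neq0 : exists x : E, x != 0) (F_neq0 : exists y : F, y != 0).
Variables (X : banachLatticeType R) (phi : {linear X -> (E -> F)}).
Hypotheses (phi_bij : set_bij [set: X] (Kr_AMun E F) phi)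
  (phi_le : forall x y : X, x <=L y <-> op_le (phi x) (phi y))
  (phi_norm : forall x : X, `|x| = AMun_norm (phi x))
  (XAM : AM_space X).

Let phi_Kr a : Kr_AMun E F (phi a). Proof. by have [+ _ _] := phi_bij; exact. Qed.

Let phi_Kpos T : Kpos_AMun T -> exists a, [/\ phi a = T, 0 <=L a & `|a| = op_norm T].
Proof.
move=> KT; have [_ _ /(_ T (Kpos_Kr KT))[a _ aT]] := phi_bij.
exists a; split=> //; first by apply/phi_le; rewrite linear0 aT; exact: KT.2.
by rewrite phi_norm aT AMun_norm_Kpos.
Qed.

Let phi_pos_Kpos a : 0 <=L a -> Kpos_AMun (phi a).
Proof.
move=> /phi_le; rewrite linear0 => a0.
by apply: am_compact_Kpos => //; exact/Kr_am_compact/phi_Kr.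
Qed.

(** Over a fixed norming functional, [y |-> f (.) y] is an isometric lattice
    embedding of [F]. *)
Lemma AM_space_codomain : AM_space F.
Proof.
have [x0 x00 nx0] := exists_vpos_neq0 E_neq0.
have [f pf fx0] := norming_functional x00.
have nrm y := rank_one_norm y pf fx0 nx0.
move=> y z y0 z0; have yz0 : 0 <=L vjoin y z := vle_tr y0 (vleUl _ _).
have [a [aT a0 na]] := phi_Kpos (rank_one_Kpos pf y0).
have [b [bT b0 nb]] := phi_Kpos (rank_one_Kpos pf z0).
have [d [dT d0 nd]] := phi_Kpos (rank_one_Kpos pf yz0).
suff dE : d = vjoin a b by rewrite -!nrm -na -nb -nd dE XAM.
have [lf f0 _] := pf.
apply: vle_asym; last first.
  apply: vleU; apply/phi_le; rewrite ?aT ?bT dT => x /f0 fx;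
    apply: vleZ => //; [exact: vleUl|exact: vleUr].
have /phi_le := vleUl a b; have /phi_le := vleUr a b.
rewrite aT bT => bW aW; apply/phi_le; rewrite dT => x xx0.
have := f0 x xx0; rewrite le_eqVlt => /predU1P[fx|fx].
  by have := aW x xx0; rewrite /rank_one -fx !scale0r.
have -> : phi (vjoin a b) x = f x *: ((f x)^-1 *: phi (vjoin a b) x).
  by rewrite scalerA divff ?scale1r// gt_eqF.
apply: vleZ; first exact: ltW.
have scal v : f x *: v <=L phi (vjoin a b) x -> v <=L (f x)^-1 *: phi (vjoin a b) x.
  move=> fv; have -> : v = (f x)^-1 *: (f x *: v).
    by rewrite scalerA mulVf ?scale1r// gt_eqF.
  by apply: vleZ => //; rewrite invr_ge0 ltW.
by apply: vleU; apply: scal; [exact: aW|exact: bW].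
Qed.

(** With [f] and [g] norming [x1] and [x2], a join of [f (.) y] and [g (.) y] maps
    [x1 + x2] above [(|x1| + |x2|) y], while its norm is at most [|y|]. *)
Lemma AL_space_domain : AL_space E.
Proof.
have [y y0 ny] := exists_vpos_neq0 F_neq0.
move=> x1 x2 x10 x20; apply/eqP; rewrite eq_le ler_normD/=.
have [f pf fx1] := norming_functional x10.
have [g pg gx2] := norming_functional x20.
have [a [aT a0 na]] := phi_Kpos (rank_one_Kpos pf y0).
have [b [bT b0 nb]] := phi_Kpos (rank_one_Kpos pg y0).
have KW := phi_pos_Kpos (vle_tr a0 (vleUl a b)).
have nW : op_norm (phi (vjoin a b)) <= `|y|.
  rewrite -AMun_norm_Kpos// -phi_norm XAM// ge_max na nb.
  by rewrite !rank_one_norm_le.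
have /phi_le := vleUl a b; have /phi_le := vleUr a b; rewrite aT bT => bW aW.
have [[lW [c c0 bdW] _] _] := Kpos_am_compact KW.
have yW : (`|x1| + `|x2|) *: y <=L phi (vjoin a b) (x1 + x2).
  rewrite scalerDl (linD lW); apply: vleD.
    by rewrite -fx1; exact: aW.
  by rewrite -gx2; exact: bW.
rewrite -(ler_pM2l (_ : 0 < `|y|)) ?normr_gt0//.
apply: (le_trans _ (ler_wpM2r (normr_ge0 _) nW)).
apply: (le_trans _ (bounded_op_norm lW c0 bdW _)).
have n0 : 0 <= `|x1| + `|x2| by rewrite addr_ge0.
rewrite mulrC -[X in X * _]ger0_norm// -normrZ.
by apply: vle_norm_ge0 => //; exact: vscale_ge0.
Qed.

End Necessity.
Set Strict Implicit.
Unset Implicit Arguments.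

Theorem theorem3p11 (R : realType) (E F : banachLatticeType R)
    (E_neq0 : exists x : E, x != 0) (F_neq0 : exists y : F, y != 0) :
  is_AM_space_under (Kr_AMun E F) op_le AMun_norm <->
  AL_space E /\ AM_space F.
Proof.
split=> [[X [phi [phi_bij phi_le phi_norm XAM]]]|[EAL FAM]].
  split; first exact: (AL_space_domain F_neq0 phi_bij phi_le phi_norm XAM).
  exact: (AM_space_codomain E_neq0 phi_bij phi_le phi_norm XAM).
exact: AM_space_sufficient.
Qed.
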